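(* Let $X_1,X_2,\dots$ be independent real random variables with $\mathbf E X_k=0$ and $\sigma_k^2:=\mathbf E X_k^2\in(0,\infty)$ for every $k\ge 1$. Put $S(n)=X_1+\dots+X_n$ and $B_n^2=\sum_{k=1}^n\sigma_k^2$ (with $B_n>0$). Assume the Lindeberg condition: for every $\varepsilon>0$, $$\frac{1}{B_n^2}\sum_{k=1}^n\mathbf E\left[X_k^2;\,|X_k|\ge\varepsilon B_n\right]\to0\quad\text{as }n\to\infty .$$ Let $\{g(n)\}_{n\ge1}$ be a real sequence with $g(n)=o(B_n)$ as $n\to\infty$, and let $T_g:=\inf\{n\ge1:\ S(n)\le g(n)\}$. Assume that $\mathbf P(T_g>n)>0$ for every $n\ge1$. Then, as $n\to\infty$, $$\mathbf P(T_g>n)\sim\sqrt{\frac{2}{\pi}}\,\frac{U_g(B_n^2)}{B_n},$$ where $U_g$ is a positive slowly varying (at infinity) function with $$U_g(B_n^2)=\mathbf E\left[S(n)-g(n);\,T_g>n\right]\sim\mathbf E\left[-S(T_g);\,T_g\le n\right]\quad\text{as }n\to\infty .$$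
   Context: $\mathbf E[Z;A]$ denotes $\mathbf E[Z\mathbf 1_A]$; $a_n\sim b_n$ means $a_n/b_n\to1$. The function $U_g$ is prescribed only at the points $B_n^2$; the assertion is that there is a positive function on $(0,\infty)$, slowly varying at infinity, taking these values at the points $B_n^2$. *)

(* Defs.v *)
From HB Require Import structures.
From mathcomp Require Import all_boot all_order all_algebra finmap.
From mathcomp Require Import all_classical all_reals all_analysis.
Set Implicit Arguments.
Unset Strict Implicit.
Unset Printing Implicit Defensive.
Import Order.TTheory GRing.Theory Num.Theory.
Import numFieldNormedType.Exports.
Local Open Scope classical_set_scope.
Local Open Scope ring_scope.

(* a_n ~ b_n. Division by 0 is 0, so this forces b_n != 0 for large n. *)
Definition asymp_equiv (R : realType) (a b : nat -> R) : Prop :=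
  a n / b n @[n --> \oo] --> (1 : R).

(* Slow variation at +oo of a function considered on (0, +oo); measurability is
   part of the standard definition. *)
Definition slowly_varying (R : realType) (L : R -> R) : Prop :=
  measurable_fun [set x : R | 0 < x] L /\
  forall c : R, 0 < c -> L (c * x) / L x @[x --> +oo] --> (1 : R).

Definition mutually_independent (d : measure_display) (Omega : measurableType d)
    (R : realType) (P : probability Omega R) (I : choiceType) (D : set I)
    (X : I -> {RV P >-> R}) : Prop :=
  forall (J : {fset I}) (A : I -> set R),
    [set` J] `<=` D -> (forall i, measurable (A i)) ->
    P (\bigcap_(i in [set` J]) (X i @^-1` A i)) =
    (\prod_(i <- J) P (X i @^-1` A i))%E.

Section first_passage_times.
Context (d : measure_display) (Omega : measurableType d) (R : realType).
Context (P : probability Omega R).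
Implicit Types (X : nat -> {RV P >-> R}) (g : nat -> R).

(* E[Z; A] = E[Z 1_A], an extended real. *)
Definition expectation_on (Z : Omega -> R) (A : set Omega) : \bar R :=
  ('E_P[fun w => (Z w * \1_A w)%R])%E.

(* Sequences X_1, X_2, ... are functions on nat whose value at 0 is unused. *)
Definition partial_sum X (n : nat) (w : Omega) : R :=
  \sum_(1 <= k < n.+1) X k w.

Definition second_moment X (k : nat) : \bar R :=
  ('E_P[fun w => (X k w ^+ 2)%R])%E.

(* fine is harmless here: second moments are assumed finite. *)
Definition Bn X (n : nat) : R :=
  Num.sqrt (\sum_(1 <= k < n.+1) fine (second_moment X k)).

Definition lindeberg X : Prop :=
  forall eps : R, 0 < eps ->
    ((Bn X n ^- 2)%:E *
       \sum_(1 <= k < n.+1)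
         expectation_on (fun w => (X k w ^+ 2)%R)
                        [set w | (eps * Bn X n <= `|X k w|)%R])%E
      @[n --> \oo] --> (0 : \bar R)%E.

(* T_g, with value +oo if S(n) > g(n) for all n >= 1. *)
Definition first_passage_time X g (w : Omega) : \bar R :=
  ereal_inf [set n%:R%:E | n in
    [set n : nat | (1 <= n)%N /\ partial_sum X n w <= g n]].

Definition T_gt X g (n : nat) : set Omega :=
  [set w | (n%:R%:E < first_passage_time X g w)%E].

Definition T_le X g (n : nat) : set Omega :=
  [set w | (first_passage_time X g w <= n%:R%:E)%E].

(* S(T_g), meaningful where T_g is finite; there T_g is a natural number,
   which truncn (fine _) recovers. *)
Definition stopped_sum X g (w : Omega) : R :=
  partial_sum X (Num.truncn (fine (first_passage_time X g w))) w.

End first_passage_times.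

(* Main.v *)
Require Import Defs.
From HB Require Import structures.
From mathcomp Require Import all_boot all_order all_algebra finmap.
From mathcomp Require Import all_classical all_reals all_analysis.
From mathcomp Require Import measurable_realfun ring lra.

(** Write S(n) for the walk, a(n) = P(T_g > n), B(n)^2 for the variance of S(n) and
V(n) = E[S(n) - g(n); T_g > n]. The theorem says that a(n) B(n) / V(n) tends to
sqrt(2 / pi) and that V, read as a function of B^2, varies slowly.

The function h(t, x) = erf(x / sqrt(2 t)) solves the heat equation; for x > 0 it
is the probability that a Brownian motion started at x stays positive up to time
t. Evaluated along the walk, with t the variance that remains to be spent plus a
small multiple of B(n)^2, it is almost a martingale: a Taylor expansion
([heat_step]) bounds the error of one step, and the Lindeberg condition makes the
sum of these errors over the n steps tend to 0 ([lindeberg_error_near]). Run this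
almost martingale from an intermediate time m with B(m) about delta B(n) until
the exit from the region above g. As h is odd and increasing in x, the exit
positions contribute at most 0 if the walk is first lowered by max |g|
([heat_killed_lower]). If it is raised a little instead, they contribute at least
minus the probability of a big jump ([heat_killed_upper]). So a(n) is
E[h(B(n)^2, S(m)); T_g > m] up to small shifts of S(m) and an error o(1) a(m).
Since h is almost linear near x = 0, with slope sqrt(2 / (pi t)), this
expectation is
sqrt(2 / pi) V(m) / B(n) up to a relative error of order delta
([survival_upper], [survival_lower]).

Three a priori facts control the errors. Survival pushes the walk up
([association]), hence a(m) B(m) <= C V(m) ([survival_prob_le]); so the error
o(1) a(m) is negligible against V(m) / B(n) for fixed delta. Optional stopping
expresses V(n) - V(m) through the overshoots at the exits between m and n, which
are o(B(n)); together with the previous bound this gives V(n) / V(m) -> 1 as long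
as B(m) >= delta B(n) ([killed_height_slowly_varies]). Finally
E[S(m)^2; T_g > m] <= K B(m) V(m) ([killed_square_le]) bounds the quadratic
correction to the linearisation of h. Letting first n tend to infinity and then
delta to 0 gives [survival_limit], and U is the step function that equals V(n) on
[B(n)^2, B(n+1)^2) ([regular_extension]). *)

Set Implicit Arguments.
Unset Strict Implicit.
Unset Printing Implicit Defensive.
Import Order.TTheory GRing.Theory Num.Theory.
Import numFieldNormedType.Exports.
Local Open Scope classical_set_scope.
Local Open Scope ring_scope.

(** * The error function *)

Section error_function.
Context {R : realType}.
Implicit Types x y z h t v : R.

Definition gauss_primitive x : R :=
  (\int[@lebesgue_measure R]_(u in `]-oo, x]) gauss_fun u)%R.

Definition erf x : R :=
  2 / Num.sqrt pi * (gauss_primitive x - gauss_primitive 0).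

Lemma is_derive_gauss_primitive x : is_derive x 1 gauss_primitive (gauss_fun x).
Proof.
have [||||D1 D2] := @continuous_FTC1 R gauss_fun -oo%O x (x + 1).
- by rewrite ltrDl.
- exact: integrableS (@integrableT_gauss R).
- by rewrite ltNyr.
- exact: continuous_gauss_fun.
apply: DeriveDef; first exact: D1.
by rewrite -derive1E D2.
Qed.

Lemma is_derive_gauss_fun x : is_derive x 1 (@gauss_fun R) (- (2 * x) * gauss_fun x).
Proof.
rewrite /gauss_fun.
by apply: is_derive_eq; rewrite /GRing.scale /=; ring.
Qed.

Lemma is_derive_erf x : is_derive x 1 erf (2 / Num.sqrt pi * gauss_fun x).
Proof.
have ? := is_derive_gauss_primitive x.
by rewrite /erf; apply: is_derive_eq; rewrite /GRing.scale /=; ring.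
Qed.

(** The orientation-free form of the mean value theorem spares the case
distinctions on the sign of the displacement in the Taylor estimates below. *)
Lemma mvt_real (f df : R -> R) (a b : R) :
  (forall x, is_derive x 1 f (df x)) ->
  exists2 c, `|c - a| <= `|b - a| & f b - f a = df c * (b - a).
Proof.
move=> fd.
have cf : continuous f.
  by move=> x; apply: differentiable_continuous; apply/derivable1_diffP; case: (fd x).
have [ab|ba] := leP a b.
  have [] := @MVT_segment _ f df a b ab (fun x _ => fd x).
    exact: continuous_subspaceT.
  move=> c; rewrite in_itv/= => /andP[ac cb] E; exists c => //.
  by rewrite !ger0_norm ?subr_ge0// lerB.
have [] := @MVT_segment _ f df b a (ltW ba) (fun x _ => fd x).
  exact: continuous_subspaceT.
move=> c; rewrite in_itv/= => /andP[bc ca] E; exists c.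
  rewrite !ler0_norm ?subr_le0 ?(ltW ba)//; lra.
by rewrite -opprB E; ring.
Qed.

Lemma sqrt_pi_ge1 : (1 : R) <= Num.sqrt pi.
Proof. by rewrite -sqrtr1 ler_wsqrtr// (le_trans _ (pi_ge2 R))// ler1n. Qed.

Lemma erf_slope_gt0 : 0 < 2 / Num.sqrt (pi : R).
Proof. by rewrite divr_gt0// (lt_le_trans ltr01)// sqrt_pi_ge1. Qed.

Lemma erf_slope_le2 : 2 / Num.sqrt (pi : R) <= 2.
Proof. by rewrite ler_pdivrMr ?(lt_le_trans ltr01 sqrt_pi_ge1)// ler_peMr// sqrt_pi_ge1. Qed.

Lemma erf0 : erf 0 = 0.
Proof. by rewrite /erf subrr mulr0. Qed.

Lemma erf_nondecreasing x y : x <= y -> erf x <= erf y.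
Proof.
move=> xy; have [c _ E] := mvt_real x y is_derive_erf.
by rewrite -subr_ge0 E !mulr_ge0 ?subr_ge0 ?gauss_fun_ge0// ltW// erf_slope_gt0.
Qed.

Lemma continuous_erf : continuous erf.
Proof.
by move=> x; apply: differentiable_continuous; apply/derivable1_diffP; case: (is_derive_erf x).
Qed.

Lemma measurable_erf : measurable_fun setT erf.
Proof. exact: continuous_measurable_fun continuous_erf. Qed.

Lemma gauss_primitive_le x : gauss_primitive x <= Num.sqrt pi.
Proof.
rewrite /gauss_primitive /Rintegral -[leRHS]/(fine (Num.sqrt pi)%:E) -integralT_gauss.
apply: fine_le.
- by apply: integrable_fin_num => //; exact: integrableS (@integrableT_gauss R).
- by apply: integrable_fin_num => //; exact: integrableT_gauss.
apply: ge0_subset_integral => //.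
- by apply/measurable_EFinP; exact: measurable_gauss_fun.
- by move=> y _; rewrite lee_fin gauss_fun_ge0.
Qed.

(** A bounded nondecreasing function has a limit at infinity; the fundamental
theorem on [0, +oo[ identifies it through the Gaussian integral. *)
Lemma cvg_erf : erf x @[x --> +oo] --> (1 : R).
Proof.
have c0 := erf_slope_gt0.
have /cvg_ex[l el] : cvg (erf x @[x --> +oo]).
  apply: cvgP; apply: nondecreasing_cvgr; first exact: erf_nondecreasing.
  exists (2 / Num.sqrt pi * (Num.sqrt pi - gauss_primitive 0)) => _ [x _ <-].
  by rewrite /erf ler_pM2l// lerD2r gauss_primitive_le.
suff -> : (1 : R) = l by [].
have := @ge0_continuous_FTC2y R (fun x => 2 / Num.sqrt pi * gauss_fun x) erf 0 l.
rewrite erf0 sube0 => H.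
apply: EFin_inj; rewrite -H {H}.
- under eq_integral do rewrite EFinM.
  rewrite ge0_integralZl//=.
  + rewrite integral0y_gauss -EFinM mulrA divfK ?divff//.
    by rewrite gt_eqF// (lt_le_trans ltr01 sqrt_pi_ge1).
  + apply/measurable_EFinP/measurable_funTS; exact: measurable_gauss_fun.
  + by move=> y _; rewrite lee_fin gauss_fun_ge0.
- by move=> x _; rewrite mulr_ge0 ?gauss_fun_ge0// ltW.
- apply: continuous_subspaceT => x.
  by apply: cvgM; [exact: cvg_cst|exact: continuous_gauss_fun].
- exact: el.
- by move=> x _; case: (is_derive_erf x).
- by have := cvg_at_right_filter (@continuous_erf 0); rewrite erf0.
- by move=> x _; rewrite derive1E; apply: (@derive_val _ _ _ _ _ _ _ (is_derive_erf x)).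
Qed.

Lemma erf_le1 x : erf x <= 1.
Proof.
apply: (cvgr_to_ge cvg_erf); near=> y.
by apply: erf_nondecreasing; near: y; apply: nbhs_pinfty_ge; exact: num_real.
Unshelve. all: by end_near. Qed.

Lemma erf_near1 (c : R) : c < 1 -> exists2 y : R, 0 < y & c <= erf y.
Proof.
move=> c1; apply: pinfty_ex_gt; first exact: num_real.
exact: cvgr_ge cvg_erf _ c1.
Qed.

Lemma erf_odd x : erf (- x) = - erf x.
Proof.
have D y : is_derive y 1 (fun y => erf y + erf (- y)) 0.
  have ? := is_derive_erf y.
  have Dn : is_derive y 1 (fun y => - y : R) (- 1) by exact: is_deriveNid.
  have ? := is_derive1_comp (is_derive_erf (- y)) Dn.
  apply: is_derive_eq; rewrite /gauss_fun sqrrN; ring.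
have [c _] := mvt_real 0 x D.
by rewrite mul0r erf0 oppr0 erf0; lra.
Qed.

Lemma erf_geN1 x : - 1 <= erf x.
Proof. by rewrite -(opprK x) erf_odd lerN2 erf_le1. Qed.

Lemma erf_ge0 x : 0 <= x -> 0 <= erf x.
Proof. by move=> x0; rewrite -erf0; exact: erf_nondecreasing. Qed.

Lemma erf_le0 x : x <= 0 -> erf x <= 0.
Proof. by move=> x0; rewrite -erf0; exact: erf_nondecreasing. Qed.

Lemma erf_le_tangent x : 0 <= x -> erf x <= 2 / Num.sqrt pi * x.
Proof.
move=> x0; have [c _] := mvt_real 0 x is_derive_erf.
rewrite erf0 !subr0 => ->; apply: ler_wpM2r => //.
by rewrite ger_pMr ?erf_slope_gt0// gauss_fun_le1.
Qed.

(** On the negative axis erf is convex, so it lies above its tangent at 0, and for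
x >= 1 the left-hand side is not positive. In between the slope is at
least that at 0 times 1 - x^2. *)
Lemma erf_ge_quadratic x : 2 / Num.sqrt pi * (x - x ^+ 2) <= erf x.
Proof.
have [c cx] := mvt_real 0 x is_derive_erf.
rewrite erf0 !subr0 => E.
rewrite E -subr_ge0.
rewrite [leRHS](_ : _ = 2 / Num.sqrt pi * (gauss_fun c * x - (x - x ^+ 2))); last by ring.
apply: mulr_ge0; first exact: ltW erf_slope_gt0.
have g1 := gauss_fun_le1 c; have g0 := gauss_fun_ge0 c.
have [x1|x1] := leP 1 x; first nra.
have [x0|x0] := leP x 0; first nra.
have gc : 1 - c ^+ 2 <= gauss_fun c by rewrite /gauss_fun; exact: expR_ge1Dx.
move: cx; rewrite !subr0 => cx.
have : c ^+ 2 <= x ^+ 2 by rewrite -(real_normK (num_real c)) -(real_normK (num_real x)) ler_sqr ?nnegrE.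
nra.
Qed.

(** Squaring 1 + z^2/2 <= exp(z^2/2). Every bound on a derivative of erf below
reduces to comparing a polynomial with the one on the left. *)
Lemma gauss_fun_poly z : (1 + z ^+ 2 + z ^+ 4 / 4) * gauss_fun z <= 1.
Proof.
have -> : gauss_fun z = (expR (z ^+ 2 / 2) ^+ 2)^-1.
  by rewrite /gauss_fun -expRM_natl -expRN; congr expR; field.
rewrite ler_pdivrMr ?exprn_gt0 ?expR_gt0// mul1r.
have -> : 1 + z ^+ 2 + z ^+ 4 / 4 = (1 + z ^+ 2 / 2) ^+ 2 by field.
by rewrite ler_sqr ?nnegrE ?expR_ge0 ?expR_ge1Dx// addr_ge0// divr_ge0// sqr_ge0.
Qed.

Lemma is_derive_erf2 x : is_derive x 1 (fun z => 2 / Num.sqrt pi * gauss_fun z)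
   (2 / Num.sqrt pi * (- (2 * x) * gauss_fun x)).
Proof.
have ? := is_derive_gauss_fun x.
by apply: is_derive_eq; rewrite /GRing.scale /=; ring.
Qed.

Lemma is_derive_erf3 x :
  is_derive x 1 (fun z => 2 / Num.sqrt pi * (- (2 * z) * gauss_fun z))
   (2 / Num.sqrt pi * ((4 * x ^+ 2 - 2) * gauss_fun x)).
Proof.
have ? := is_derive_gauss_fun x.
by apply: is_derive_eq; rewrite /GRing.scale /=; ring.
Qed.

End error_function.

(** * Heat flow of the error function *)

Section heat_kernel.
Context {R : realType}.
Implicit Types x y z h t v r : R.

(** One remainder that yields both the cubic bound (from a Lipschitz bound on f2)
and the quadratic one (from a bound on f2) that a Lindeberg argument needs. *)
Lemma taylor2_remainder (f f1 f2 : R -> R) z h :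
  (forall y, is_derive y 1 f (f1 y)) -> (forall y, is_derive y 1 f1 (f2 y)) ->
  exists2 c, `|c| <= `|h| &
    `|f (z + h) - f z - f1 z * h - f2 z * (h ^+ 2 / 2)| <=
    `|f2 (z + c) - f2 z| * h ^+ 2.
Proof.
move=> df df1.
have Ds r : is_derive r 1 (fun r => z + r) 1.
  by apply: is_derive_eq; rewrite add0r mulr1.
have D0 r : is_derive r 1 (fun r => f (z + r) - f z - f1 z * r - f2 z * (r ^+ 2 / 2))
    (f1 (z + r) - f1 z - f2 z * r).
  have ? := is_derive1_comp (df (z + r)) (Ds r).
  by apply: is_derive_eq; rewrite /GRing.scale /=; field.
have D1 r : is_derive r 1 (fun r => f1 (z + r) - f1 z - f2 z * r)
    (f2 (z + r) - f2 z).
  have ? := is_derive1_comp (df1 (z + r)) (Ds r).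
  by apply: is_derive_eq; rewrite /GRing.scale /=; field.
have [c0 c0h E0] := mvt_real 0 h D0.
have [c1 c1c E1] := mvt_real 0 c0 D1.
move: E0 E1 c0h c1c; rewrite /= !subr0 !addr0 !subrr expr0n /= !mul0r !mulr0 !subr0.
move=> -> -> c0h c1c; exists c1; first exact: le_trans c0h.
rewrite !normrM -mulrA ler_wpM2l// -[leRHS]real_normK ?num_real//.
by rewrite expr2 ler_wpM2r.
Qed.

Let e2 z : R := 2 / Num.sqrt pi * (- (2 * z) * gauss_fun z).
Let e3 z : R := 2 / Num.sqrt pi * ((4 * z ^+ 2 - 2) * gauss_fun z).

Let gauss_bound z (p C : R) : 0 <= C -> `|p| <= C * (1 + z ^+ 2 + z ^+ 4 / 4) ->
  `|2 / Num.sqrt pi * (p * gauss_fun z)| <= 2 * C.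
Proof.
move=> C0 pC; have c0 := @erf_slope_gt0 R.
rewrite normrM (ger0_norm (ltW c0)); apply: ler_pM => //; rewrite ?(ltW c0) ?erf_slope_le2//.
rewrite normrM (ger0_norm (gauss_fun_ge0 z)).
apply: (le_trans (ler_wpM2r (gauss_fun_ge0 z) pC)).
by rewrite -mulrA ler_piMr// gauss_fun_poly.
Qed.

Let e2_bound z : `|e2 z| <= 4.
Proof.
rewrite /e2 [leRHS](_ : _ = 2 * 2); last by ring.
apply: gauss_bound => //.
rewrite ler_norml; apply/andP; split; nra.
Qed.

Let e3_bound z : `|e3 z| <= 8.
Proof.
rewrite /e3 [leRHS](_ : _ = 2 * 4); last by ring.
apply: gauss_bound => //.
rewrite ler_norml; apply/andP; split; nra.
Qed.

Let ze3_bound z : `|e3 z * z| <= 12.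
Proof.
rewrite /e3 [leRHS](_ : _ = 2 * 6); last by ring.
rewrite [X in `|X|](_ : _ =
  2 / Num.sqrt pi * ((4 * z ^+ 2 - 2) * z * gauss_fun z)); last by ring.
apply: gauss_bound => //.
have : 0 <= z ^+ 2 * (1 - z / 2) ^+ 2 by rewrite mulr_ge0 ?sqr_ge0.
have : 0 <= z ^+ 2 * (1 + z / 2) ^+ 2 by rewrite mulr_ge0 ?sqr_ge0.
rewrite ler_norml; move=> H1 H2; apply/andP; split; nra.
Qed.

Lemma erf_taylor z h :
  `|erf (z + h) - erf z - 2 / Num.sqrt pi * gauss_fun z * h - e2 z * (h ^+ 2 / 2)|
   <= 8 * h ^+ 2 * Num.min 1 `|h|.
Proof.
have [c ch H] := taylor2_remainder z h (@is_derive_erf R) (@is_derive_erf2 R).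
apply: (le_trans H).
rewrite (mulrAC 8) ler_wpM2r ?sqr_ge0//.
rewrite minr_pMr// mulr1 le_min; apply/andP; split.
  have := e2_bound (z + c); have := e2_bound z.
  have := ler_normB (e2 (z + c)) (e2 z); rewrite /e2; lra.
have [d _ ->] := mvt_real z (z + c) (@is_derive_erf3 R).
rewrite normrM (addrC z) addrK; apply: ler_pM => //; exact: e3_bound.
Qed.

(** The probability that a Brownian motion started at x > 0 stays positive up to
time t, continued to an odd function of x. *)
Definition heat t x : R := erf (x / Num.sqrt (2 * t)).

Let sqr_sqrt2 t : 0 < t -> Num.sqrt (2 * t) ^+ 2 = 2 * t.
Proof. by move=> t0; rewrite sqr_sqrtr// mulr_ge0// ltW. Qed.

Let sqrt2_gt0 t : 0 < t -> 0 < Num.sqrt (2 * t).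
Proof. by move=> t0; rewrite sqrtr_gt0 mulr_gt0. Qed.

Let z x r := x / Num.sqrt (2 * r).

Let is_derive_z x r : 0 < r -> is_derive r 1 (z x) (- z x r / (2 * r)).
Proof.
move=> r0.
have k0 := sqrt2_gt0 r0.
have r2 : 0 < 2 * r by rewrite mulr_gt0.
have D2 : is_derive r 1 (fun r => 2 * r : R) 2.
  by apply: is_derive_eq; rewrite /GRing.scale /= mulr1 ?mulr0 ?addr0.
have D := is_derive1_comp (is_derive1_sqrt r2) D2.
have DV := @is_deriveV _ (fun r : R => Num.sqrt (2 * r)) r _ _ (lt0r_neq0 k0) D.
rewrite /z; apply: is_derive_eq; rewrite /GRing.scale /=.
have := sqr_sqrt2 r0; move: k0; set k := Num.sqrt _ => k0 <-.
by field; rewrite gt_eqF.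
Qed.

(** The right-hand side is also half of the second derivative in x: this is the
heat equation, and it makes the second order terms cancel in [heat_step]. *)
Lemma is_derive_heat x r : 0 < r ->
  is_derive r 1 (heat^~ x) (e2 (z x r) / (4 * r)).
Proof.
move=> r0; have D := is_derive1_comp (is_derive_erf (z x r)) (is_derive_z x r0).
have -> : heat^~ x = erf \o z x by [].
apply: is_derive_eq; rewrite /e2; field.
by rewrite !gt_eqF// (lt_le_trans ltr01 (@sqrt_pi_ge1 R)).
Qed.

Let is_derive_heat2 x r : 0 < r ->
  is_derive r 1 (fun r => e2 (z x r) / (4 * r))
    (- (e3 (z x r) * z x r) / (8 * r ^+ 2) - e2 (z x r) / (4 * r ^+ 2)).
Proof.
move=> r0; have D := is_derive1_comp (@is_derive_erf3 R (z x r)) (is_derive_z x r0).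
have D4 : is_derive r 1 (fun r => 4 * r : R) 4.
  by apply: is_derive_eq; rewrite /GRing.scale /= mulr1 ?mulr0 ?addr0.
have r4 : 4 * r != 0 by rewrite mulf_neq0 ?gt_eqF.
have DV := @is_deriveV _ (fun r : R => 4 * r) r _ _ r4 D4.
have D' : is_derive r 1 (fun r => e2 (z x r)) (e3 (z x r) * (- z x r / (2 * r))) by exact: D.
apply: is_derive_eq; rewrite /GRing.scale /=; field.
by rewrite gt_eqF.
Qed.

Let mvt_pos (f df : R -> R) t u : 0 < t -> t <= u ->
  (forall r, 0 < r -> is_derive r 1 f (df r)) ->
  exists2 c, t <= c <= u & f u - f t = df c * (u - t).
Proof.
move=> t0 tu fd.
have [||c] := @MVT_segment _ f df t u tu; last first.
- by rewrite in_itv/=; exists c.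
- apply: continuous_in_subspaceT => r; rewrite inE/= in_itv/= => /andP[tr _].
  apply: differentiable_continuous; apply/derivable1_diffP.
  by case: (fd r (lt_le_trans t0 tr)).
- by move=> r; rewrite in_itv/= => /andP[tr _]; apply: fd; exact: lt_trans tr.
Qed.

Lemma heat_time_taylor x t v : 0 < t -> 0 <= v ->
  `|heat (t + v) x - heat t x - e2 (z x t) / (4 * t) * v| <= 3 * (v / t) ^+ 2.
Proof.
move=> t0 v0; have tv : t <= t + v by rewrite lerDl.
have [c /andP[tc cv] E] := mvt_pos t0 tv (is_derive_heat x).
have [d /andP[td dc] E'] := mvt_pos t0 tc (is_derive_heat2 x).
have d0 := lt_le_trans t0 td.
rewrite E [t + v - t]addrAC subrr add0r -mulrBl E' !normrM.
have -> : 3 * (v / t) ^+ 2 = 3 / t ^+ 2 * v * v by field; rewrite gt_eqF.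
rewrite (ger0_norm v0); apply: ler_wpM2r => //.
apply: ler_pM => //; last by rewrite ger0_norm ?subr_ge0//; lra.
apply: (@le_trans _ _ (3 / d ^+ 2)); last first.
  by rewrite ler_pM2l// lef_pV2 ?posrE ?exprn_gt0// ler_sqr ?nnegrE ?(ltW t0) ?(ltW d0).
have -> : - (e3 (z x d) * z x d) / (8 * d ^+ 2) - e2 (z x d) / (4 * d ^+ 2) =
  (- (e3 (z x d) * z x d) / 8 - e2 (z x d) / 4) / d ^+ 2.
  by field; rewrite gt_eqF.
rewrite normrM normfV (ger0_norm (sqr_ge0 d)) ler_pM2r ?invr_gt0 ?exprn_gt0//.
have := ze3_bound (z x d); have := e2_bound (z x d).
move: (e3 _ * _) (e2 _) => E3 E2; by rewrite !ler_norml => /andP[? ?] /andP[? ?]; apply/andP; split; lra.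
Qed.

(** Spending the variance v on a centred random step y of variance v changes
[heat] by the linear term A y, by B (y^2 - v), and by an error. The first two have
mean zero. Steps below the threshold L are charged with the cubic remainder, the
others with the quadratic one. *)
Lemma heat_step t v x : 0 < t -> 0 <= v ->
  exists A B : R, forall (y L : R), 0 < L ->
  `|heat t (x + y) - heat (t + v) x - A * y - B * (y ^+ 2 - v)| <=
  4 / t * (L / Num.sqrt t * y ^+ 2 + y ^+ 2 * (L <= `|y|)%R%:R) + 3 * (v / t) ^+ 2.
Proof.
move=> t0 v0; have k0 := sqrt2_gt0 t0.
exists (2 / Num.sqrt pi * gauss_fun (z x t) / Num.sqrt (2 * t)), (e2 (z x t) / (4 * t)).
move=> y L L0.
have H1 := heat_time_taylor x t0 v0.
have := erf_taylor (z x t) (y / Num.sqrt (2 * t)).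
rewrite /z -mulrDl -/(heat t (x + y)) -/(heat t x) -/(z x t).
have -> : e2 (z x t) * ((y / Num.sqrt (2 * t)) ^+ 2 / 2) = e2 (z x t) / (4 * t) * y ^+ 2.
  rewrite expr_div_n sqr_sqrt2//; field; by rewrite gt_eqF.
move=> H2.
have H3 : 8 * (y / Num.sqrt (2 * t)) ^+ 2 * Num.min 1 `|y / Num.sqrt (2 * t)| <=
   4 / t * (L / Num.sqrt t * y ^+ 2 + y ^+ 2 * (L <= `|y|)%R%:R).
  rewrite expr_div_n sqr_sqrt2//.
  have -> : 8 * (y ^+ 2 / (2 * t)) = 4 / t * y ^+ 2 by field; rewrite gt_eqF.
  rewrite -[leLHS]mulrA ler_pM2l ?divr_gt0//.
  rewrite (mulrC _ (y ^+ 2)) -mulrDr ler_wpM2l ?sqr_ge0//.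
  have s0 : 0 <= L / Num.sqrt t by rewrite divr_ge0 ?sqrtr_ge0 ?ltW.
  have [Ly|yL] := leP L `|y|; first by rewrite ge_min; apply/orP; left; rewrite /=; lra.
  rewrite addr0 ge_min; apply/orP; right.
  rewrite normrM normfV (ger0_norm (ltW k0)); apply: ler_pM; [by []|by rewrite invr_ge0 ltW|exact: ltW|].
  rewrite lef_pV2 ?posrE ?sqrtr_gt0 ?mulr_gt0// ler_wsqrtr//; lra.
apply: (@le_trans _ _ (`|heat t (x + y) - heat t x - 2 / Num.sqrt pi * gauss_fun (z x t) * (y / Num.sqrt (2 * t)) - e2 (z x t) / (4 * t) * y ^+ 2| + `|heat (t + v) x - heat t x - e2 (z x t) / (4 * t) * v|)); last first.
  by apply: lerD => //; exact: le_trans H3.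
apply: le_trans (ler_normB _ _); rewrite le_eqVlt; apply/orP; left; apply/eqP; congr `|_|.
move: (heat t (x + y)) (heat (t + v) x) (heat t x) (e2 _) (gauss_fun _) => h1 h2 h3 E G; ring.
Qed.

End heat_kernel.

(** * Independence of the past and the next increment *)

Section independent_increments.
Context {d : measure_display} {Omega : measurableType d} {R : realType}.
Context (P : probability Omega R) (X : nat -> {RV P >-> R}).
Hypothesis indep : mutually_independent [set k : nat | (1 <= k)%N] X.

Lemma fin_prob (A : set Omega) : measurable A -> P A \is a fin_num.
Proof. by move=> mA; exact: fin_num_measure. Qed.

(** All coordinates may be constrained by setT, so that these sets form a
pi-system that generates the information carried by the first n increments. *)
Definition past_cylinder (n : nat) : set (set Omega) :=
  [set A | exists2 B : nat -> set R, (forall i, measurable (B i)) &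
    A = \bigcap_(i in [set i : nat | (1 <= i <= n)%N]) X i @^-1` B i].

Definition past (n : nat) : set (set Omega) := <<s past_cylinder n >>.

Lemma past_cylinder_setI n : setI_closed (past_cylinder n).
Proof.
move=> _ _ [B mB ->] [C mC ->]; exists (fun i => B i `&` C i).
  by move=> i; exact: measurableI.
by rewrite -bigcapI.
Qed.

Lemma measurable_preX k (B : set R) : measurable B -> measurable (X k @^-1` B).
Proof. by move=> mB; exact: measurable_funPTI. Qed.

Lemma past_cylinder_measurable n A : past_cylinder n A -> measurable A.
Proof.
move=> [B mB ->]; apply: bigcap_measurableType => i _; exact: measurable_preX.
Qed.

Lemma past_measurable n A : past n A -> measurable A.
Proof.
apply: smallest_sub => //; last exact: past_cylinder_measurable.
exact: sigma_algebra_measurable.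
Qed.

Let range_fset n : {fset nat} := [fset i | i in iota 1 n]%fset.

Let range_fsetE n : [set` range_fset n] = [set i : nat | (1 <= i <= n)%N].
Proof.
apply/seteqP; split => i /=; rewrite /range_fset !inE /= mem_iota add1n ltnS//.
Qed.

Lemma past_cylinder_indep n A B : past_cylinder n A -> measurable B ->
  P (A `&` X n.+1 @^-1` B) = (P A * P (X n.+1 @^-1` B))%E.
Proof.
move=> [C mC ->] mB.
pose C' i := if i == n.+1 then B else C i.
have mC' i : measurable (C' i) by rewrite /C'; case: ifP.
have -> : (\bigcap_(i in [set i : nat | (1 <= i <= n)%N]) X i @^-1` C i) `&`
    X n.+1 @^-1` B =
  \bigcap_(i in [set` (n.+1 |` range_fset n)%fset]) X i @^-1` C' i.
  rewrite set_fsetU1 bigcap_setU1 range_fsetE setIC /C' eqxx; congr (_ `&` _).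
  apply: eq_bigcapr => i /= /andP[_ ni].
  by rewrite ltn_eqF// ltnS.
rewrite (@indep (n.+1 |` range_fset n)%fset C' _ mC'); last first.
  by rewrite set_fsetU1 range_fsetE => i /= [->//|/andP[]].
rewrite big_fsetU1/=; last first.
  by rewrite !inE mem_iota add1n ltnn andbF.
rewrite -range_fsetE (@indep (range_fset n) C _ mC); last first.
  by rewrite range_fsetE => i /= /andP[].
rewrite {1}/C' eqxx muleC; congr (_ * _)%E.
rewrite big_seq [RHS]big_seq; apply: eq_bigr => i.
rewrite !inE mem_iota add1n => /andP[_ ni].
by rewrite /C' ltn_eqF.
Qed.

(** Dynkin's theorem: the sets independent of the next increment form a
lambda-system, which contains the cylinders. *)
Lemma past_indep n A B : past n A -> measurable B ->
  P (A `&` X n.+1 @^-1` B) = (P A * P (X n.+1 @^-1` B))%E.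
Proof.
move=> + mB; set E := X n.+1 @^-1` B.
have mE : measurable E by exact: measurable_preX.
pose H := [set A | measurable A /\ P (A `&` E) = (P A * P E)%E].
suff : past n `<=` H by move=> sub /sub[].
apply: lambda_system_subset => //; first exact: past_cylinder_setI; last first.
  move=> C nC; split; first exact: past_cylinder_measurable nC.
  exact: past_cylinder_indep.
split => //.
- by split=> //; rewrite setTI probability_setT mul1e.
- move=> C D DC [mC CE] [mD DE]; split; first exact: measurableD.
  have CD : C `&` D = D by rewrite setIidr.
  have -> : (C `\` D) `&` E = (C `&` E) `\` D.
    by apply/seteqP; split => w /= [] [].
  rewrite measureD ?(le_lt_trans (probability_le1 _ _)) ?ltry//; try exact: measurableI.
  rewrite measureD ?(le_lt_trans (probability_le1 _ _)) ?ltry//.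
  rewrite muleBl ?fin_prob//; last by rewrite fin_num_adde_defr // fin_prob.
  rewrite CD -setIA (setIC E) setIA CD. by congr (_ - _)%E.
- move=> F ndF HF; have mF i : measurable (F i) by case: (HF i).
  have mU : measurable (\bigcup_i F i) by exact: bigcup_measurable.
  split => //; rewrite setI_bigcupl.
  have c1 : P (F i `&` E) @[i --> \oo] --> P (\bigcup_i (F i `&` E)).
    apply: (@nondecreasing_cvg_mu _ _ _ P (fun i => F i `&` E)).
    - by move=> i; exact: measurableI.
    - by apply: bigcup_measurable => i _; exact: measurableI.
    - by move=> i j ij; apply/subsetPset; apply: setSI; apply/subsetPset; exact: ndF.
  have c2 : P (F i `&` E) @[i --> \oo] --> (P (\bigcup_i F i) * P E)%E.
    under eq_fun do rewrite (HF _).2.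
    apply: cvgeZr; [exact: fin_prob|exact: nondecreasing_cvg_mu].
  exact: cvg_unique c1 c2.
Qed.

(** The sample space with the smaller sigma-algebra of the past. Joint
measurability over past_type n * R then says exactly that a function depends on
the past and on one more real argument. *)
Definition past_type n := g_sigma_algebraType (past_cylinder n).

Definition forget n : Omega -> past_type n := id.

Lemma measurable_forget n : measurable_fun setT (forget n).
Proof. by move=> _ A pA; rewrite setTI; exact: past_measurable pA. Qed.

HB.instance Definition _ n :=
  isMeasurableFun.Build _ _ _ _ (forget n) (@measurable_forget n).

Definition with_next n (w : Omega) : past_type n * R := (w, X n.+1 w).

Lemma measurable_with_next n : measurable_fun setT (with_next n).
Proof.
apply/measurable_fun_pairP; split; first exact: measurable_forget.
exact: measurable_funP.
Qed.

HB.instance Definition _ n :=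
  isMeasurableFun.Build _ _ _ _ (with_next n) (@measurable_with_next n).

(** On rectangles, independence identifies the law of (past, next increment) with
a product measure; uniqueness of product measures and Fubini do the rest. This is
the conditional expectation given the past, obtained by integrating out the next
increment. *)
Lemma past_fubini n (phi : past_type n * R -> R) :
  measurable_fun setT phi ->
  P.-integrable setT (fun w => (phi (with_next n w))%:E) ->
  (forall w, P.-integrable setT (fun v => (phi (w, X n.+1 v))%:E)) ->
  P.-integrable setT (fun w => (\int[P]_v phi (w, X n.+1 v))%:E) /\
  \int[P]_w phi (with_next n w) =
  \int[P]_w (\int[P]_v phi (w, X n.+1 v)).
Proof.
move=> mphi iphi iphiw.
pose m1 := distribution P (forget n); pose m2 := distribution P (X n.+1).
pose m' := distribution P (with_next n).
have m'E A B : measurable A -> measurable B -> m' (A `*` B) = (m1 A * m2 B)%E.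
  move=> mA mB; rewrite /m' /distribution /pushforward.
  have := past_indep mA mB; rewrite /m1 /m2 /distribution /pushforward /= => <-.
  by congr (P _).
have uniq := product_measure_unique m'E.
have mphi' : measurable_fun setT (EFin \o phi) by exact/measurable_EFinP.
have im' : m'.-integrable setT (EFin \o phi).
  apply: integrable_pushforward => //; exact: measurable_with_next.
have im : (m1 \x m2)%E.-integrable setT (EFin \o phi).
  apply/integrableP; split => //; case/integrableP: im' => _; apply: le_lt_trans.
  rewrite le_eqVlt; apply/orP; left; apply/eqP.
  by apply: eq_measure_integral => A mA _; rewrite /= uniq.
have E1 : (\int[P]_w (phi (with_next n w))%:E = \int[m']_z (phi z)%:E)%E.
  rewrite (integral_pushforward (@measurable_with_next n) mphi')//.
have E2 : (\int[m']_z (phi z)%:E = \int[m1]_w \int[m2]_x (phi (w, x))%:E)%E.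
  have := integral12_prod_meas1 im; rewrite /fubini_F/= => ->.
  by apply: eq_measure_integral => A mA _; rewrite /= uniq.
have iF := integrable_fubini_F im.
have FE w : fubini_F m2 (EFin \o phi) w = (\int[P]_v phi (w, X n.+1 v))%:E.
  have mw : measurable_fun setT (fun x => (phi (w, x))%:E).
    exact: measurableT_comp mphi' (measurable_pair1 _).
  have mX : measurable_fun setT (X n.+1) by exact: measurable_funP.
  rewrite /fubini_F /= (integral_pushforward mX mw (iphiw w) measurableT).
  by rewrite /= /Rintegral fineK//; exact: integrable_fin_num.
have iF' : m1.-integrable setT (fun w => (\int[P]_v phi (w, X n.+1 v))%:E).
  by apply: eq_integrable iF => // x _; rewrite FE.
have mF' : measurable_fun setT (fun w : past_type n => (\int[P]_v phi (w, X n.+1 v))%:E).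
  exact: (measurable_int m1).
have iP : P.-integrable setT (fun w => (\int[P]_v phi (w, X n.+1 v))%:E).
  apply/integrableP; split.
    exact: (measurableT_comp mF' (@measurable_forget n)).
  case/integrableP: iF' => _; rewrite (ge0_integral_pushforward (@measurable_forget n))//.
  by apply: measurableT_comp.
split => //; rewrite /Rintegral E1 E2; congr fine.
transitivity (\int[m1]_w (\int[P]_v phi (w, X n.+1 v))%:E)%E.
  by apply: eq_integral => w _; rewrite -FE.
by rewrite (integral_pushforward (@measurable_forget n) mF').
Qed.

End independent_increments.

(** * The walk killed at the moving boundary *)

Section killed_walk.
Context {d : measure_display} {Omega : measurableType d} {R : realType}.
Context (P : probability Omega R) (X : nat -> {RV P >-> R}) (g : nat -> R).
Hypothesis indep : mutually_independent [set k : nat | (1 <= k)%N] X.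
Hypothesis mean0 : forall k : nat, (1 <= k)%N -> ('E_P[X k] = 0)%E.
Hypothesis var_pos_fin : forall k : nat, (1 <= k)%N ->
  (0 < second_moment X k < +oo)%E.

Local Notation S := (partial_sum X).
Local Notation D := (T_gt X g).
Local Notation integ f := (P.-integrable setT (EFin \o f)).
Local Notation Pr A := (fine (P A)).

Lemma integ_on A f : measurable A -> integ f -> P.-integrable A (EFin \o f).
Proof. by move=> mA; apply: integrableS. Qed.

Lemma integ_bounded (f : Omega -> R) C : measurable_fun setT f ->
  (forall w, `|f w| <= C) -> integ f.
Proof.
move=> mf fC; apply: measurable_bounded_integrable => //.
  by rewrite (le_lt_trans (probability_le1 _ _)) ?ltry.
exists C; split; first exact: num_real.
by move=> M CM w _; apply: (le_trans (fC w)); exact: ltW.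
Qed.

Lemma integ_le (f h : Omega -> R) : measurable_fun setT f ->
  (forall w, `|f w| <= h w) -> integ h -> integ f.
Proof.
move=> mf fh; apply: le_integrable => //; first exact/measurable_EFinP.
by move=> w _ /=; rewrite lee_fin (le_trans (fh w))// ler_norm.
Qed.

Lemma integD (f h : Omega -> R) : integ f -> integ h -> integ (fun w => f w + h w).
Proof. by move=> i1 i2; exact: (integrableD measurableT i1 i2). Qed.

Lemma integB (f h : Omega -> R) : integ f -> integ h -> integ (fun w => f w - h w).
Proof. by move=> i1 i2; exact: (integrableB measurableT i1 i2). Qed.

Lemma integZ c (f : Omega -> R) : integ f -> integ (fun w => c * f w).
Proof. by move=> i1; exact: (integrableZl measurableT c i1). Qed.

Lemma integ_cst (c : R) : integ (fun=> c).
Proof. by apply: (@integ_bounded _ `|c|) => //; exact: measurable_cst. Qed.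

Lemma Rintegral_indic A (f : Omega -> R) :
  \int[P]_(w in A) f w = \int[P]_w (f w * \1_A w).
Proof.
rewrite Rintegral_mkcond; apply: eq_Rintegral => w _.
by rewrite patch_indic.
Qed.

Lemma measurable_X k : measurable_fun setT (X k).
Proof. exact: measurable_funP. Qed.

Lemma integ_X2 k : (1 <= k)%N -> integ (fun w => X k w ^+ 2).
Proof.
move=> /var_pos_fin/andP[_ fin]; apply/integrableP; split.
  by apply/measurable_EFinP; apply: measurable_funX; exact: measurable_X.
move: fin; rewrite /second_moment unlock; apply: le_lt_trans.
by under eq_integral do rewrite /= ger0_norm ?sqr_ge0//.
Qed.

Lemma integ_X k : (1 <= k)%N -> integ (X k).
Proof.
move=> k1; apply: (@integ_le _ (fun w => 1 + X k w ^+ 2)); first exact: measurable_X.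
  by move=> w; rewrite -real_normK ?num_real//; have := normr_ge0 (X k w); nra.
by apply: integD; [exact: integ_cst|exact: integ_X2].
Qed.

Lemma partial_sum0 w : S 0%N w = 0.
Proof. by rewrite /partial_sum big_geq. Qed.

Lemma partial_sumS n w : S n.+1 w = S n w + X n.+1 w.
Proof. by rewrite /partial_sum big_nat_recr. Qed.

Lemma past_X n k : (1 <= k <= n)%N -> measurable_fun setT (X k : past_type X n -> R).
Proof.
move=> kn _ B mB; rewrite setTI; apply: sub_sigma_algebra.
exists (fun i => if i == k then B else setT); first by move=> i; case: ifP.
apply/seteqP; split => w /=.
  by move=> XB i /= _; case: ifP => // /eqP ->.
by move=> /(_ k kn); rewrite eqxx.
Qed.

Lemma past_partial_sum n k : (k <= n)%N -> measurable_fun setT (S k : past_type X n -> R).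
Proof.
elim: k => [|k IH] kn.
  rewrite (_ : S 0%N = cst 0); last by apply/funext => w; exact: partial_sum0.
  exact: measurable_cst.
rewrite (_ : S k.+1 = (fun w => S k w + X k.+1 w)); last by apply/funext => w; exact: partial_sumS.
by apply: measurable_funD; [apply: IH; exact: ltnW|exact: past_X].
Qed.

Lemma measurable_partial_sum k : measurable_fun setT (S k).
Proof.
move=> _ B mB; apply: (@past_measurable _ _ _ _ X k).
exact: (past_partial_sum (leqnn k)).
Qed.

(** The hitting time takes values in the positive integers and +oo, so T_g > n
only constrains the first n positions. *)
Lemma survivalE n : D n = [set w | forall j, (1 <= j <= n)%N -> g j < S j w].
Proof.
rewrite /T_gt/=; apply/seteqP; split => w /=.
  move=> + j /andP[j1 jn]; rewrite ltNge => H; rewrite ltNge; apply: contra H => Sg.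
  apply: (@le_trans _ _ (j%:R)%:E); last by rewrite lee_fin ler_nat.
  by apply: ereal_inf_lbound; exists j.
move=> H; apply: (@lt_le_trans _ _ (n.+1%:R)%:E); first by rewrite lte_fin ltr_nat.
apply: le_ereal_inf_tmp => _ [j [j1 Sg] <-]; rewrite lee_fin ler_nat ltnNge.
apply/negP => jn; have := H j; rewrite j1 jn => /(_ isT).
by rewrite ltNge Sg.
Qed.

Lemma survival0 : D 0%N = setT.
Proof. by rewrite survivalE; apply/seteqP; split => // w _ j; case: j. Qed.

Lemma survivalS n : D n.+1 = D n `&` [set w | g n.+1 < S n.+1 w].
Proof.
rewrite !survivalE; apply/seteqP; split => w /=.
  move=> H; split; last by apply: H; rewrite ltnS leqnn.
  by move=> j /andP[j1 jn]; apply: H; rewrite j1 leqW.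
move=> [H Hn] j /andP[j1]; rewrite leq_eqVlt => /orP[/eqP->//|jn].
by apply: H; rewrite j1.
Qed.

Lemma past_survival n k : (k <= n)%N -> past X n (D k).
Proof.
elim: k => [_|k IH kn].
  rewrite survival0; exact: (@measurableT _ (past_type X n)).
rewrite survivalS; apply: (@measurableI _ (past_type X n)); first exact: IH (ltnW kn).
have := @past_partial_sum n k.+1 kn measurableT _ (measurable_itv `]g k.+1, +oo[).
rewrite setTI; congr (measurable _).
by apply/seteqP; split => w /=; rewrite in_itv/= andbT.
Qed.

Lemma measurable_survival n : measurable (D n).
Proof. exact: past_measurable (past_survival (leqnn n)). Qed.

Lemma integ_partial_sum2 n : integ (fun w => S n w ^+ 2).
Proof.
elim: n => [|n IH].
  by apply: eq_integrable (integ_cst 0) => // w _ /=; rewrite partial_sum0 expr0n.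
apply: (@integ_le _ (fun w => 2 * S n w ^+ 2 + 2 * X n.+1 w ^+ 2)).
- by apply: measurable_funX; exact: measurable_partial_sum.
- move=> w; rewrite ger0_norm ?sqr_ge0// partial_sumS.
  have := sqr_ge0 (S n w - X n.+1 w); nra.
- by apply: integD; apply: integZ => //; exact: integ_X2.
Qed.

Lemma integ_partial_sum n : integ (S n).
Proof.
apply: (@integ_le _ (fun w => 1 + S n w ^+ 2)); first exact: measurable_partial_sum.
  by move=> w; rewrite -real_normK ?num_real//; have := normr_ge0 (S n w); nra.
by apply: integD; [exact: integ_cst|exact: integ_partial_sum2].
Qed.

(** The conditional form of [past_fubini] for functions of the current position
and the next increment, localised on an event A of the past. *)
Lemma next_step n A (phi : R * R -> R) : past X n A ->
  measurable_fun setT phi ->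
  integ (fun w => phi (S n w, X n.+1 w)) ->
  (forall y, integ (fun w => phi (y, X n.+1 w))) ->
  integ (fun w => \int[P]_v phi (S n w, X n.+1 v)) /\
  \int[P]_(w in A) phi (S n w, X n.+1 w) =
  \int[P]_(w in A) (\int[P]_v phi (S n w, X n.+1 v)).
Proof.
move=> pA mphi iphi iphiy; have mA := past_measurable pA.
have main B : past X n B ->
  integ (fun w => (\int[P]_v (phi (S n w, X n.+1 v) * \1_B w))) /\
  \int[P]_w (phi (S n w, X n.+1 w) * \1_B w) =
  \int[P]_w (\int[P]_v (phi (S n w, X n.+1 v) * \1_B w)).
  move=> pB; have mB := past_measurable pB.
  apply: (@past_fubini _ _ _ P X indep n
     (fun z : past_type X n * R => phi (S n z.1, z.2) * \1_B z.1)).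
  - apply: measurable_funM.
      apply: (measurableT_comp mphi); apply/measurable_fun_pairP; split.
        apply: (measurableT_comp (past_partial_sum (leqnn n))); exact: measurable_fst.
      exact: measurable_snd.
    apply: (measurableT_comp (f := \1_B : past_type X n -> R)); last exact: measurable_fst.
    exact: measurable_indic.
  - apply: (@integ_le _ (fun w => `|phi (S n w, X n.+1 w)|)).
    + apply: measurable_funM; first by apply/measurable_EFinP; exact: (measurable_int P).
      exact: measurable_indic.
    + by move=> w; rewrite normrM ler_piMr// indicE normr_nat lern1 leq_b1.
    + exact: integrable_norm.
  - move=> w; rewrite /=; under eq_fun do rewrite mulrC; exact: integZ.
split.
  have [+ _] := main setT (@measurableT _ (past_type X n)).
  apply: eq_integrable => // w _ /=; congr (_%:E).
  by apply: eq_Rintegral => v _; rewrite indicT mulr1.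
rewrite Rintegral_indic (main A pA).2 [RHS]Rintegral_indic.
apply: eq_Rintegral => w _; rewrite RintegralZr//; exact: iphiy.
Qed.

Lemma next_indep n A (h : R -> R) : past X n A -> measurable_fun setT h ->
  integ (fun w => h (X n.+1 w)) ->
  \int[P]_(w in A) h (X n.+1 w) = (\int[P]_w h (X n.+1 w)) * Pr A.
Proof.
move=> pA mh ih; have mA := past_measurable pA.
have mphi : measurable_fun setT (fun z : R * R => h z.2).
  by apply: (measurableT_comp mh); exact: measurable_snd.
have [_ /= ->] := next_step pA mphi ih (fun=> ih).
by rewrite Rintegral_cst.
Qed.

Lemma Rexpectation (f : Omega -> R) : \int[P]_w f w = fine 'E_P[f].
Proof. by rewrite unlock. Qed.

Lemma Rexpectation_cst (c : R) : \int[P]_w c = c.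
Proof.
by rewrite Rintegral_cst// -[X in fine X]/(P setT) probability_setT mulr1.
Qed.

Lemma next_mean0 n A : past X n A -> \int[P]_(w in A) X n.+1 w = 0.
Proof.
move=> pA; rewrite (@next_indep n A id)// ?Rexpectation ?mean0 ?mul0r//.
exact: integ_X.
Qed.

Lemma next_var n A : past X n A ->
  \int[P]_(w in A) X n.+1 w ^+ 2 = fine (second_moment X n.+1) * Pr A.
Proof.
move=> pA; rewrite (@next_indep n A (fun x => x ^+ 2))//; last exact: integ_X2.
by rewrite Rexpectation.
Qed.

Lemma next_cross n A : past X n A -> \int[P]_(w in A) (S n w * X n.+1 w) = 0.
Proof.
move=> pA; have mA := past_measurable pA.
have mphi : measurable_fun setT (fun z : R * R => z.1 * z.2).
  by apply: measurable_funM; [exact: measurable_fst|exact: measurable_snd].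
have iphi : integ (fun w => S n w * X n.+1 w).
  apply: (@integ_le _ (fun w => S n w ^+ 2 + X n.+1 w ^+ 2)).
  + by apply: measurable_funM; [exact: measurable_partial_sum|exact: measurable_X].
  + move=> w; have := sqr_ge0 (S n w - X n.+1 w); have := sqr_ge0 (S n w + X n.+1 w).
    by rewrite ler_norml => H1 H2; apply/andP; split; nra.
  + by apply: integD; [exact: integ_partial_sum2|exact: integ_X2].
have [_ /= ->] := next_step pA mphi iphi (fun y => integZ y (integ_X (ltn0Sn n))).
transitivity (\int[P]_(w in A) (0 : R)); last by rewrite Rintegral_cst// mul0r.
apply: eq_Rintegral => w _; rewrite /= RintegralZl//; last exact: integ_X.
by rewrite Rexpectation mean0//= mulr0.
Qed.

Lemma survival_split n (f : Omega -> R) : integ f ->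
  \int[P]_(w in D n) f w = \int[P]_(w in D n.+1) f w +
    \int[P]_(w in D n `\` D n.+1) f w.
Proof.
move=> intf; have m1 := measurable_survival n; have m2 := measurable_survival n.+1.
have sub : D n.+1 `<=` D n by rewrite survivalS; exact: subIsetl.
rewrite -{1}(setDUK sub) Rintegral_setU//.
- exact: measurableD.
- by rewrite setDUK//; exact: integ_on.
- by rewrite disj_set2E setDE setICA setICr setI0.
Qed.

End killed_walk.

(** * One step of the killed walk *)

Section one_step.
Context {d : measure_display} {Omega : measurableType d} {R : realType}.
Context (P : probability Omega R) (X : nat -> {RV P >-> R}) (g : nat -> R).
Hypothesis indep : mutually_independent [set k : nat | (1 <= k)%N] X.
Hypothesis mean0 : forall k : nat, (1 <= k)%N -> ('E_P[X k] = 0)%E.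
Hypothesis var_pos_fin : forall k : nat, (1 <= k)%N ->
  (0 < second_moment X k < +oo)%E.

Local Notation S := (partial_sum X).
Local Notation D := (T_gt X g).
Local Notation integ f := (P.-integrable setT (EFin \o f)).
Local Notation Pr A := (fine (P A)).

Definition variance_at k : R := fine (second_moment X k).
(** The k-th term of the Lindeberg sum, with truncation level L. *)
Definition large_variance k (L : R) : R :=
  \int[P]_w (X k w ^+ 2 * (L <= `|X k w|)%R%:R).
Definition survival_prob n : R := Pr (D n).
Definition killed_mean n : R := \int[P]_(w in D n) S n w.
Definition killed_square n : R := \int[P]_(w in D n) S n w ^+ 2.
Definition killed_height n : R := \int[P]_(w in D n) (S n w - g n).

Local Notation a := survival_prob.
Local Notation W := killed_mean.
Local Notation V := killed_height.
Local Notation M := killed_square.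

Let iS n := @integ_partial_sum _ _ _ P X var_pos_fin n.
Let iS2 n := @integ_partial_sum2 _ _ _ P X var_pos_fin n.
Let mD n := @measurable_survival _ _ _ P X g n.
Let mS n := @measurable_partial_sum _ _ _ P X n.
Let pD n := @past_survival _ _ _ P X g n n (leqnn n).

Lemma real_prob_ge0 (A : set Omega) : 0 <= Pr A.
Proof. exact: fine_ge0. Qed.

Lemma measurable_exit n : measurable (D n `\` D n.+1).
Proof. exact: measurableD. Qed.

Lemma survival_prob_ge0 n : 0 <= a n. Proof. exact: fine_ge0. Qed.

Lemma survival_prob0 : a 0%N = 1.
Proof. by rewrite /survival_prob survival0 probability_setT. Qed.

Lemma exit_prob n : Pr (D n `\` D n.+1) = a n - a n.+1.
Proof.
have := survival_split X g n (integ_cst P 1).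
rewrite !Rintegral_cst ?mul1r//; last exact: measurable_exit.
by rewrite /survival_prob; lra.
Qed.

Lemma survival_prob_decrS n : a n.+1 <= a n.
Proof. by have := real_prob_ge0 (D n `\` D n.+1); rewrite exit_prob; lra. Qed.

Lemma survival_prob_decr m n : (m <= n)%N -> a n <= a m.
Proof.
move=> /subnK <-; elim: (n - m)%N => // k; apply: le_trans; rewrite addSn.
exact: survival_prob_decrS.
Qed.

Lemma variance_at_gt0 k : (1 <= k)%N -> 0 < variance_at k.
Proof. by move=> /var_pos_fin ?; rewrite fine_gt0. Qed.

Lemma survival_gt n w : (1 <= n)%N -> D n w -> g n < S n w.
Proof. by case: n => // n _; rewrite survivalS => -[]. Qed.

Lemma exit_le n w : (D n `\` D n.+1) w -> S n.+1 w <= g n.+1.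
Proof.
by rewrite survivalS => -[Dn H]; rewrite leNgt; apply/negP => gS; apply: H.
Qed.

Lemma killed_heightE n : V n = W n - g n * a n.
Proof.
rewrite /killed_height RintegralB ?Rintegral_cst//; apply: integ_on => //.
exact: integ_cst.
Qed.

Lemma killed_height_gt0 n : (1 <= n)%N -> 0 < a n -> 0 < V n.
Proof.
move=> n1 an0; rewrite lt0r; apply/andP; split; last first.
  by apply: Rintegral_ge0 => w Dw; rewrite subr_ge0 ltW// survival_gt.
apply/negP => /eqP V0; move: an0; rewrite lt0r => /andP[/negP + _]; apply.
have i0 : P.-integrable (D n) (EFin \o (fun w => S n w - g n)).
  by apply: integ_on => //; apply: integB => //; exact: integ_cst.
have absE : (\int[P]_(w in D n) `|(S n w - g n)%:E| = 0)%E.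
  transitivity (\int[P]_(w in D n) (S n w - g n)%:E)%E.
    apply: eq_integral => w /set_mem Dw.
    by rewrite gee0_abs// lee_fin subr_ge0 ltW// survival_gt.
  by rewrite -(fineK (integrable_fin_num _ i0))//; congr EFin.
have [N [mN N0 sub]] := (ae_eq_integral_abs P (mD n) (measurable_int P i0)).1 absE.
apply/eqP; rewrite /survival_prob (_ : P (D n) = 0)%E//.
apply: (subset_measure0 (mD n) mN) => // w Dw; apply: sub => /= /(_ Dw) [/eqP].
by rewrite subr_eq0 gt_eqF// survival_gt.
Qed.

(** Optional stopping: the increment has mean zero on the past event that the
walk is still alive, so the mean changes only by the positions at exit. *)
Lemma killed_meanS n : W n.+1 = W n - \int[P]_(w in D n `\` D n.+1) S n.+1 w.
Proof.
have E : \int[P]_(w in D n) S n.+1 w = W n.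
  under eq_Rintegral do rewrite partial_sumS.
  rewrite RintegralD//; try exact: integ_on.
    by rewrite (next_mean0 indep mean0 var_pos_fin (@pD n)) addr0.
  by apply: integ_on => //; exact: integ_X.
by have := survival_split X g n (iS n.+1); rewrite E /killed_mean; lra.
Qed.

Lemma killed_mean0 : W 0%N = 0.
Proof.
rewrite /killed_mean; under eq_Rintegral do rewrite partial_sum0.
by rewrite Rintegral_cst// mul0r.
Qed.

Lemma killed_squareS n : M n.+1 <= M n + variance_at n.+1 * a n.
Proof.
have E : \int[P]_(w in D n) S n.+1 w ^+ 2 = M n + variance_at n.+1 * a n.
  have iX := @integ_X _ _ _ P X var_pos_fin n.+1 isT.
  have iX2 := @integ_X2 _ _ _ P X var_pos_fin n.+1 isT.
  have iSX : integ (fun w => S n w * X n.+1 w).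
    apply: (@integ_le _ _ _ _ _ (fun w => S n w ^+ 2 + X n.+1 w ^+ 2)).
    + by apply: measurable_funM => //; exact: measurable_X.
    + move=> w; have := sqr_ge0 (S n w - X n.+1 w); have := sqr_ge0 (S n w + X n.+1 w).
      by rewrite ler_norml => H1 H2; apply/andP; split; nra.
    + exact: integD.
  transitivity (\int[P]_(w in D n) (S n w ^+ 2 + (2 * (S n w * X n.+1 w) + X n.+1 w ^+ 2))).
    by apply: eq_Rintegral => w _; rewrite partial_sumS; ring.
  have i2 : integ (fun w => 2 * (S n w * X n.+1 w)) by exact: integZ.
  rewrite RintegralD//; [|exact: integ_on|by apply: integ_on => //; exact: integD].
  rewrite RintegralD//; [|exact: integ_on|exact: integ_on].
  rewrite RintegralZl//; last exact: integ_on.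
  by rewrite (next_cross indep mean0 var_pos_fin (@pD n)) (next_var indep var_pos_fin (@pD n)) mulr0 add0r.
have := survival_split X g n (iS2 n.+1); rewrite E /killed_square => ->.
rewrite lerDl; apply: Rintegral_ge0 => w _; exact: sqr_ge0.
Qed.

Lemma killed_mean_lower n : W n - `|g n.+1| * (a n - a n.+1) <= W n.+1.
Proof.
rewrite killed_meanS lerD2l lerN2 -exit_prob -Rintegral_cst; last exact: measurable_exit.
apply: le_Rintegral; [exact: measurable_exit| | |].
- by apply: integ_on => //; exact: measurable_exit.
- by apply: integ_on; [exact: measurable_exit|exact: integ_cst].
- by move=> w /exit_le Sg; rewrite (le_trans Sg)// ler_norm.
Qed.

Lemma measurable_ge_norm (L : R) : measurable_fun setT (fun x : R => (L <= `|x|)%R%:R : R).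
Proof.
rewrite [X in measurable_fun _ X](_ : _ = \1_[set x : R | L <= `|x|]).
  apply: measurable_indic.
  have mn : measurable_fun setT (@Num.norm R R) by exact: normr_measurable.
  have := mn measurableT _ (measurable_itv `[L, +oo[); rewrite setTI.
  by congr measurable; apply/seteqP; split => x /=; rewrite in_itv/= andbT.
by apply/funext => x; rewrite indicE; congr (nat_of_bool _)%:R; apply/idP/asboolP.
Qed.

Lemma measurable_large (L : R) :
  measurable_fun setT (fun x : R => x ^+ 2 * (L <= `|x|)%R%:R : R).
Proof.
by apply: measurable_funM; [apply: measurable_funX; exact: measurable_id|exact: measurable_ge_norm].
Qed.

Lemma large_variance_integ k (L : R) : (1 <= k)%N ->
  integ (fun w => X k w ^+ 2 * (L <= `|X k w|)%R%:R).
Proof.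
move=> k1; apply: (@integ_le _ _ _ _ _ (fun w => X k w ^+ 2)); last exact: integ_X2.
  exact: (measurableT_comp (measurable_large L) (measurable_X X k)).
by move=> w; rewrite normrM ger0_norm ?sqr_ge0// ler_piMr ?sqr_ge0// normr_nat lern1 leq_b1.
Qed.

Lemma large_variance_ge0 k L : 0 <= large_variance k L.
Proof. by apply: Rintegral_ge0 => w _; rewrite mulr_ge0 ?sqr_ge0. Qed.

Lemma next_large_variance n A (L : R) : past X n A ->
  \int[P]_(w in A) (X n.+1 w ^+ 2 * (L <= `|X n.+1 w|)%R%:R) =
  large_variance n.+1 L * Pr A.
Proof.
move=> pA; rewrite (@next_indep _ _ _ P X indep n A (fun x => x ^+ 2 * (L <= `|x|)%R%:R))//.
  exact: measurable_large.
exact: large_variance_integ.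
Qed.

Lemma integ_large_prob k (L : R) : integ (fun w => (L <= `|X k w|)%R%:R).
Proof.
apply: (@integ_bounded _ _ _ _ _ 1).
  exact: (measurableT_comp (measurable_ge_norm L) (measurable_X X k)).
by move=> w; rewrite normr_nat lern1 leq_b1.
Qed.

Lemma next_large_prob n A (L : R) : past X n A -> 0 < L ->
  \int[P]_(w in A) (L <= `|X n.+1 w|)%R%:R <= large_variance n.+1 L / L ^+ 2 * Pr A.
Proof.
move=> pA L0; have mA := past_measurable pA.
have il := @large_variance_integ n.+1 L isT.
rewrite mulrAC -next_large_variance// -RintegralZr//; last exact: integ_on.
apply: le_Rintegral => //.
- apply: integ_on => //; exact: integ_large_prob.
- apply: integ_on => //; rewrite (_ : (fun w => _) =
    (fun w => (L ^+ 2)^-1 * (X n.+1 w ^+ 2 * (L <= `|X n.+1 w|)%R%:R))).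
    exact: integZ.
  by apply/funext => w; rewrite mulrC.
- move=> w _; case: (leP L `|X n.+1 w|) => [LX|_]; last by rewrite !mulr0 mul0r.
  rewrite mulr1 ler_pdivlMr ?exprn_gt0// mul1r -(@real_normK _ (X n.+1 w)) ?num_real//.
  by rewrite ler_sqr ?nnegrE ?(ltW L0).
Qed.

(** At an exit the walk was above -G just before, so it lies below -G - L only
after a jump larger than L; such jumps are charged to the truncated variance. *)
Lemma killed_mean_upper n (G L : R) : 0 < L -> (forall j, (j <= n)%N -> - G <= g j) ->
  0 <= G ->
  W n.+1 <= W n + (G + L) * (a n - a n.+1) + large_variance n.+1 L / L * a n.
Proof.
move=> L0 gG G0.
have il := @large_variance_integ n.+1 L isT.
have mE := @measurable_exit n.
pose f w := G + L + L^-1 * (X n.+1 w ^+ 2 * (L <= `|X n.+1 w|)%R%:R).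
have iL : integ (fun w => L^-1 * (X n.+1 w ^+ 2 * (L <= `|X n.+1 w|)%R%:R)) by exact: integZ.
have iF : integ f by apply: integD => //; exact: integ_cst.
have H1 : \int[P]_(w in D n `\` D n.+1) (- S n.+1 w) <= \int[P]_(w in D n `\` D n.+1) f w.
  apply: le_Rintegral => //; [|exact: integ_on|].
    apply: integ_on => //; apply: eq_integrable (integZ (-1) (iS n.+1)) => // w _ /=.
    by rewrite mulN1r.
  move=> w [Dn _]; rewrite /f partial_sumS.
  have Sn : - G <= S n w.
    case: (n) Dn gG => [|k] Dk gG; first by rewrite partial_sum0 oppr_le0.
    by apply: (le_trans (gG k.+1 (leqnn _))); rewrite ltW// survival_gt.
  suff : - X n.+1 w <= L + L^-1 * (X n.+1 w ^+ 2 * (L <= `|X n.+1 w|)%R%:R) by lra.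
  case: (leP L `|X n.+1 w|) => [LX|XL].
    rewrite mulr1; apply: (@le_trans _ _ `|X n.+1 w|); first by rewrite -normrN ler_norm.
    have : `|X n.+1 w| <= L^-1 * X n.+1 w ^+ 2; last by lra.
    rewrite mulrC ler_pdivlMr// -(@real_normK _ (X n.+1 w)) ?num_real// expr2.
    by apply: ler_wpM2l.
  rewrite mulr0 mulr0 addr0; apply: le_trans (ltW XL); by rewrite -normrN ler_norm.
have H2 : \int[P]_(w in D n `\` D n.+1) (- S n.+1 w) = W n.+1 - W n.
  rewrite killed_meanS.
  under eq_Rintegral do rewrite -mulN1r.
  rewrite RintegralZl//; last exact: integ_on.
  lra.
have H3 : \int[P]_(w in D n `\` D n.+1) f w = (G + L) * (a n - a n.+1) +
   \int[P]_(w in D n `\` D n.+1) (L^-1 * (X n.+1 w ^+ 2 * (L <= `|X n.+1 w|)%R%:R)).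
  rewrite RintegralD//; [|by apply: integ_on => //; exact: integ_cst|exact: integ_on].
  by rewrite Rintegral_cst// exit_prob.
have H4 : \int[P]_(w in D n `\` D n.+1) (L^-1 * (X n.+1 w ^+ 2 * (L <= `|X n.+1 w|)%R%:R))
   <= large_variance n.+1 L / L * a n.
  rewrite RintegralZl//; last exact: integ_on.
  rewrite mulrAC (mulrC L^-1) ler_pM2r ?invr_gt0//.
  rewrite -next_large_variance//.
  have := survival_split X g n il => ->; rewrite lerDr.
  by apply: Rintegral_ge0 => w _; rewrite mulr_ge0 ?sqr_ge0.
lra.
Qed.

(** A Harris-type inequality: conditioning on survival can only increase the law of
the position in the stochastic order. The next increment preserves this order, as
f may be replaced by its average over that increment, and so does the restriction
to a half-line. *)
Lemma association n (f : R -> R) :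
  (forall x y, x <= y -> f x <= f y) -> (forall x, 0 <= f x <= 1) ->
  (\int[P]_w f (S n w)) * a n <= \int[P]_(w in D n) f (S n w).
Proof.
elim: n f => [|n IH] f ndf f01.
  by rewrite survival_prob0 survival0 mulr1.
have mf : measurable_fun setT f by apply: nondecreasing_measurable.
have fbd (Y : Omega -> R) : measurable_fun setT Y -> integ (fun w => f (Y w)).
  move=> mY; apply: (@integ_bounded _ _ _ _ _ 1); first exact: measurableT_comp.
  by move=> w; have /andP[f0 f1] := f01 (Y w); rewrite ger0_norm.
(* F is again nondecreasing with values in [0, 1], so that the induction
   hypothesis applies to it. *)
pose F y := \int[P]_v f (y + X n.+1 v).
have mphi : measurable_fun setT (fun z : R * R => f (z.1 + z.2)).
  apply: (measurableT_comp mf); apply: measurable_funD; [exact: measurable_fst|exact: measurable_snd].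
have iphi : integ (fun w => f (S n w + X n.+1 w)).
  by apply: fbd; apply: measurable_funD => //; exact: measurable_X.
have iphiy y : integ (fun w => f (y + X n.+1 w)).
  by apply: fbd; apply: measurable_funD; [exact: measurable_cst|exact: measurable_X].
have step A : past X n A -> \int[P]_(w in A) f (S n.+1 w) = \int[P]_(w in A) F (S n w).
  move=> pA; under eq_Rintegral do rewrite partial_sumS.
  by have [_] := next_step indep pA mphi iphi iphiy.
have HF : \int[P]_w f (S n.+1 w) * a n <= \int[P]_(w in D n) f (S n.+1 w).
  rewrite (step _ (@pD n)) (step setT); last exact: (@measurableT _ (past_type X n)).
  apply: IH.
    by move=> x y xy; apply: le_Rintegral => // v _; apply: ndf; rewrite lerD2r.
  move=> x; apply/andP; split; first by apply: Rintegral_ge0 => v _; case/andP: (f01 (x + X n.+1 v)).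
  apply: (@le_trans _ _ (\int[P]_v (1 : R))).
    by apply: le_Rintegral => //; [exact: integ_cst|move=> v _; case/andP: (f01 (x + X n.+1 v))].
  by rewrite Rexpectation_cst.
have ifS := fbd _ (@mS n.+1).
have mE := @measurable_exit n.
have H1 : f (g n.+1) * a n.+1 <= \int[P]_(w in D n.+1) f (S n.+1 w).
  rewrite -Rintegral_cst//; apply: le_Rintegral => //; [apply: integ_on => //; exact: integ_cst|exact: integ_on|].
  by move=> w Dw; apply: ndf; rewrite ltW// survival_gt.
have H2 : \int[P]_(w in D n `\` D n.+1) f (S n.+1 w) <= f (g n.+1) * (a n - a n.+1).
  rewrite -exit_prob -Rintegral_cst//; apply: le_Rintegral => //; [exact: integ_on|apply: integ_on => //; exact: integ_cst|].
  by move=> w Dw; apply: ndf; exact: exit_le.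
rewrite (survival_split X g n ifS) in HF.
move: H1 H2 HF.
set E1 := \int[P]_(w in D n.+1) _; set E2 := \int[P]_(w in _ `\` _) _; set e := \int[P]_w _.
have := survival_prob_ge0 n.+1; have := survival_prob_decrS n.
set p := a n; set q := a n.+1; set c := f _ => qp q0 H1 H2 HF.
(* Writing c for the value of f at the boundary, the inequality E1 * p >= e * p * q
   follows from c * q <= E1 and E2 <= c * (p - q). *)
have [p0|p0] := eqVneq p 0.
  have -> : q = 0 by apply/eqP; rewrite eq_le q0 -p0 qp.
  by rewrite mulr0; apply: Rintegral_ge0 => w _; case/andP: (f01 (S n.+1 w)).
have {p0}p0 : 0 < p by rewrite lt0r p0 (le_trans q0).
rewrite -(ler_pM2r p0).
have : c * q * (p - q) <= E1 * (p - q) by rewrite ler_wpM2r// subr_ge0.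
have : E2 * q <= c * (p - q) * q by rewrite ler_wpM2r.
have : e * p * q <= (E1 + E2) * q by rewrite ler_wpM2r.
lra.
Qed.

Lemma measurable_heat (t b : R) (T : measurableType d) (Y : T -> R) :
  measurable_fun setT Y -> measurable_fun setT (fun w => heat t (Y w + b)).
Proof.
move=> mY; apply: (measurableT_comp measurable_erf).
apply: measurable_funM; last exact: measurable_cst.
by apply: measurable_funD => //; exact: measurable_cst.
Qed.

Lemma heat_norm_le1 (t x : R) : `|heat t x| <= 1.
Proof. by rewrite ler_norml erf_geN1 erf_le1. Qed.

Lemma integ_heat (t b : R) (Y : Omega -> R) :
  measurable_fun setT Y -> integ (fun w => heat t (Y w + b)).
Proof.
move=> mY; apply: (@integ_bounded _ _ _ _ _ 1); first exact: measurable_heat.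
by move=> w; exact: heat_norm_le1.
Qed.

(** The mean of the error in [heat_step]. *)
Definition lindeberg_error k (t L : R) : R :=
  4 / t * (L / Num.sqrt t * variance_at k + large_variance k L) +
  3 * (variance_at k / t) ^+ 2.

Lemma heat_mean_step n (t L y : R) : 0 < t -> 0 < L ->
  `|\int[P]_v heat t (y + X n.+1 v) - heat (t + variance_at n.+1) y| <=
  lindeberg_error n.+1 t L.
Proof.
move=> t0 L0; have v0 := ltW (@variance_at_gt0 n.+1 isT).
have [A [B H]] := heat_step y t0 v0.
have iX := @integ_X _ _ _ P X var_pos_fin n.+1 isT.
have iX2 := @integ_X2 _ _ _ P X var_pos_fin n.+1 isT.
have il := @large_variance_integ n.+1 L isT.
have EX : \int[P]_v X n.+1 v = 0 by rewrite Rexpectation mean0.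
have EX2 : \int[P]_v X n.+1 v ^+ 2 = variance_at n.+1 by rewrite Rexpectation.
have E1 (c : R) : \int[P]_v c = c by exact: Rexpectation_cst.
have ih : integ (fun v => heat t (y + X n.+1 v)).
  under eq_fun do rewrite addrC; apply: integ_heat; exact: measurable_X.
have iAX : integ (fun v => A * X n.+1 v) by exact: integZ.
have iB : integ (fun v => B * (X n.+1 v ^+ 2 - variance_at n.+1)).
  by apply: integZ; apply: integB => //; exact: integ_cst.
have ic := integ_cst P.
pose f v := heat t (y + X n.+1 v) - heat (t + variance_at n.+1) y - A * X n.+1 v -
  B * (X n.+1 v ^+ 2 - variance_at n.+1).
have i1 : integ (fun v => heat t (y + X n.+1 v) - heat (t + variance_at n.+1) y).
  exact: (integB ih (ic _)).
have i2 : integ (fun v => heat t (y + X n.+1 v) - heat (t + variance_at n.+1) y - A * X n.+1 v).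
  exact: (integB i1 iAX).
have i3 : integ f by exact: (integB i2 iB).
have Ef : \int[P]_v heat t (y + X n.+1 v) - heat (t + variance_at n.+1) y = \int[P]_v f v.
  rewrite /f (RintegralB measurableT i2 iB) (RintegralB measurableT i1 iAX).
  rewrite (RintegralB measurableT ih (ic _)).
  have iXv : integ (fun v => X n.+1 v ^+ 2 - variance_at n.+1) by exact: integB.
  rewrite (RintegralZl A measurableT iX) (RintegralZl B measurableT iXv).
  by rewrite (RintegralB measurableT iX2 (ic _)) !E1 EX EX2 subrr !mulr0 !subr0.
rewrite Ef; apply: le_trans (le_normr_Rintegral measurableT i3) _.
pose h v := 4 / t * (L / Num.sqrt t * X n.+1 v ^+ 2 + X n.+1 v ^+ 2 * (L <= `|X n.+1 v|)%R%:R)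
  + 3 * (variance_at n.+1 / t) ^+ 2.
have iL : integ (fun v => L / Num.sqrt t * X n.+1 v ^+ 2) by exact: integZ.
have iL2 : integ (fun v => L / Num.sqrt t * X n.+1 v ^+ 2 + X n.+1 v ^+ 2 * (L <= `|X n.+1 v|)%R%:R).
  exact: integD.
have iL3 := integZ (4 / t) iL2.
have ihh : integ h by exact: integD.
apply: (@le_trans _ _ (\int[P]_v h v)).
  by apply: le_Rintegral => //; [exact: integrable_norm|move=> v _; exact: H].
rewrite /h (RintegralD measurableT iL3 (ic _)) (RintegralZl (4 / t) measurableT iL2).
by rewrite (RintegralD measurableT iL il) (RintegralZl _ measurableT iX2) E1 EX2.
Qed.

Lemma heat_survival_step n A (t L b : R) : past X n A -> 0 < t -> 0 < L ->
  `|\int[P]_(w in A) heat t (S n.+1 w + b) -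
    \int[P]_(w in A) heat (t + variance_at n.+1) (S n w + b)| <=
  lindeberg_error n.+1 t L * Pr A.
Proof.
move=> pA t0 L0; have mA := past_measurable pA.
have mphi : measurable_fun setT (fun z : R * R => heat t (z.1 + z.2 + b)).
  apply: (measurableT_comp measurable_erf).
  apply: measurable_funM; last exact: measurable_cst.
  apply: measurable_funD; last exact: measurable_cst.
  apply: measurable_funD; [exact: measurable_fst|exact: measurable_snd].
have iphi : integ (fun w => heat t (S n w + X n.+1 w + b)).
  by apply: integ_heat; apply: measurable_funD => //; exact: measurable_X.
have iphiy y : integ (fun w => heat t (y + X n.+1 w + b)).
  by apply: integ_heat; apply: measurable_funD => //; exact: measurable_X.
have [iF E] := next_step indep pA mphi iphi iphiy.
under eq_Rintegral do rewrite partial_sumS.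
have ih := integ_heat (t + variance_at n.+1) b (@mS n).
rewrite E /= -(RintegralB mA (integ_on mA iF) (integ_on mA ih)).
have id : integ (fun w => \int[P]_v heat t (S n w + X n.+1 v + b) -
   heat (t + variance_at n.+1) (S n w + b)).
  exact: (integB iF ih).
apply: (le_trans (le_normr_Rintegral mA (integ_on mA id))).
rewrite -Rintegral_cst//; apply: le_Rintegral => //.
- by apply: integ_on => //; exact: integrable_norm.
- by apply: integ_on => //; exact: integ_cst.
move=> w _; have := heat_mean_step n (S n w + b) t0 L0.
by under eq_Rintegral do rewrite addrAC.
Qed.

End one_step.

(** * Consequences of the Lindeberg condition *)

Section lindeberg_consequences.
Context {d : measure_display} {Omega : measurableType d} {R : realType}.
Context (P : probability Omega R) (X : nat -> {RV P >-> R}) (g : nat -> R).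
Hypothesis indep : mutually_independent [set k : nat | (1 <= k)%N] X.
Hypothesis mean0 : forall k : nat, (1 <= k)%N -> ('E_P[X k] = 0)%E.
Hypothesis var_pos_fin : forall k : nat, (1 <= k)%N ->
  (0 < second_moment X k < +oo)%E.
Hypothesis lind : lindeberg X.
Hypothesis g_small : g =o_\oo Bn X.

Local Notation B := (Bn X).
Local Notation v := (variance_at X).
Local Notation integ f := (P.-integrable setT (EFin \o f)).

Definition large_variance_sum n (L : R) : R := \sum_(1 <= k < n.+1) large_variance X k L.
Local Notation Lam := large_variance_sum.

Lemma Bn_sqrS n : B n.+1 ^+ 2 = B n ^+ 2 + v n.+1.
Proof.
have s0 m : 0 <= \sum_(1 <= k < m.+1) fine (second_moment X k).
  rewrite big_nat_cond; apply: sumr_ge0 => k; rewrite andbT => /andP[k1 _].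
  exact: ltW (variance_at_gt0 var_pos_fin k1).
by rewrite /Bn !sqr_sqrtr// big_nat_recr.
Qed.

Lemma Bn0 : B 0%N = 0.
Proof. by rewrite /Bn big_geq// sqrtr0. Qed.

Lemma Bn_ge0 n : 0 <= B n. Proof. exact: sqrtr_ge0. Qed.

Lemma Bn_ltS n : B n < B n.+1.
Proof.
rewrite -ltr_sqr ?nnegrE ?Bn_ge0// Bn_sqrS ltrDl.
exact: (variance_at_gt0 var_pos_fin (ltn0Sn n)).
Qed.

Lemma Bn_le m n : (m <= n)%N -> B m <= B n.
Proof.
move=> /subnK <-; elim: (n - m)%N => // k /le_trans; apply; rewrite addSn.
exact: ltW (Bn_ltS _).
Qed.

Lemma Bn_gt0 n : (1 <= n)%N -> 0 < B n.
Proof. by case: n => // n _; exact: le_lt_trans (Bn_ge0 n) (Bn_ltS n). Qed.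

Lemma Bn_sqr_sum n : B n ^+ 2 = \sum_(1 <= k < n.+1) v k.
Proof.
elim: n => [|n IH]; first by rewrite Bn0 expr0n big_geq.
rewrite Bn_sqrS IH [RHS]big_nat_recr//.
Qed.

Lemma large_variance_sum_ge0 n L : 0 <= Lam n L.
Proof. by apply: sumr_ge0 => k _; exact: large_variance_ge0. Qed.

Lemma large_varianceE k L : (1 <= k)%N ->
  expectation_on P (fun w => X k w ^+ 2) [set w | L <= `|X k w|] = (large_variance X k L)%:E.
Proof.
move=> k1; have il := @large_variance_integ _ _ _ P X var_pos_fin k L k1.
rewrite /large_variance /Rintegral fineK; last exact: integrable_fin_num.
rewrite /expectation_on unlock; apply: eq_integral => w _.
by rewrite indicE; congr (_ * (nat_of_bool _)%:R)%:E; apply/asboolP/idP.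
Qed.

Lemma lindeberg_near (e : R) : 0 < e ->
  forall t : R, 0 < t -> \forall n \near \oo, Lam n (e * B n) <= t * B n ^+ 2.
Proof.
move=> e0 t t0; have /fine_cvgP[_ /cvgrPdist_le /(_ t t0)] := lind e0.
move=> H; near=> n.
have n1 : (1 <= n)%N by near: n; exact: nbhs_infty_ge.
have : `|0 - fine ((Bn X n ^- 2)%:E * \sum_(1 <= k < n.+1)
   expectation_on P (fun w => (X k w ^+ 2)%R) [set w | (e * B n <= `|X k w|)%R])%E| <= t.
  by near: n; exact: H.
rewrite big_nat_cond; under eq_bigr => k /andP[/andP[k1 _] _] do rewrite large_varianceE//.
rewrite -big_nat_cond sumEFin -EFinM /= sub0r normrN -/(Lam _ _).
have B0 := Bn_gt0 n1.
rewrite ger0_norm; last by rewrite mulr_ge0 ?large_variance_sum_ge0// invr_ge0 exprn_ge0// Bn_ge0.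
by rewrite mulrC ler_pdivrMr ?exprn_gt0.
Unshelve. all: by end_near. Qed.

Lemma variance_le_truncated k (L : R) : (1 <= k)%N -> v k <= L ^+ 2 + large_variance X k L.
Proof.
move=> k1.
have iX2 := @integ_X2 _ _ _ P X var_pos_fin k k1.
have il := @large_variance_integ _ _ _ P X var_pos_fin k L k1.
have -> : v k = \int[P]_w X k w ^+ 2 by rewrite Rexpectation.
rewrite -(Rexpectation_cst P (L ^+ 2)) -(RintegralD measurableT (integ_cst _ _) il).
apply: le_Rintegral => //; first by apply: integD => //; exact: integ_cst.
move=> w _; case: (leP L `|X k w|) => [LX|XL].
  by rewrite mulr1 lerDr sqr_ge0.
rewrite mulr0 addr0 -(@real_normK _ (X k w)) ?num_real//.
by rewrite ler_sqr ?nnegrE// ltW// (le_lt_trans _ XL).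
Qed.

Lemma large_variance_le_sum k n L : (1 <= k <= n)%N -> large_variance X k L <= Lam n L.
Proof.
move=> /andP[k1 kn]; rewrite /large_variance_sum (bigD1_seq k) ?iota_uniq//=; last first.
  by rewrite mem_index_iota k1 ltnS.
by rewrite lerDl; apply: sumr_ge0 => i _; exact: large_variance_ge0.
Qed.

(** Lindeberg implies Feller: a step has variance at most the square of the
truncation level plus its truncated variance. *)
Lemma variance_negligible (e : R) : 0 < e ->
  \forall n \near \oo, forall k, (1 <= k <= n)%N -> v k <= e * B n ^+ 2.
Proof.
move=> e0; pose c := Num.min 1 (e / 2).
have c0 : 0 < c by rewrite lt_min ltr01/= divr_gt0.
have ce : c <= e / 2 by rewrite ge_min lexx orbT.
have c1 : c <= 1 by rewrite ge_min lexx.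
near=> n => k /andP[k1 kn].
have H : Lam n (c * B n) <= e / 2 * B n ^+ 2.
  by near: n; apply: lindeberg_near => //; rewrite divr_gt0.
apply: (le_trans (variance_le_truncated (c * B n) k1)).
have := @large_variance_le_sum k n (c * B n); rewrite k1 kn => /(_ isT) H2.
have b0 := sqr_ge0 (B n).
have : (c * B n) ^+ 2 <= e / 2 * B n ^+ 2.
  by rewrite exprMn ler_wpM2r//; nra.
lra.
Unshelve. all: by end_near. Qed.

(** The first increment has positive variance, which must become negligible. *)
Lemma Bn_near_ge (K : R) : \forall n \near \oo, K <= B n.
Proof.
have v1 : 0 < v 1%N by exact: (variance_at_gt0 var_pos_fin (ltn0Sn 0)).
pose e := v 1%N / (K ^+ 2 + 1).
have K0 : 0 < K ^+ 2 + 1 by rewrite ltr_wpDl// sqr_ge0.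
have e0 : 0 < e by rewrite divr_gt0.
near=> n.
have n1 : (1 <= n)%N by near: n; exact: nbhs_infty_ge.
have H : forall k, (1 <= k <= n)%N -> v k <= e * B n ^+ 2.
  by near: n; exact: variance_negligible.
have := H 1%N; rewrite n1 => /(_ isT).
rewrite /e mulrAC ler_pdivlMr// ler_pM2l// => H1.
have := Bn_ge0 n; have := sqr_ge0 (K - B n); nra.
Unshelve. all: by end_near. Qed.

Lemma Bn_ratio (e : R) : 0 < e -> \forall n \near \oo, B n.+1 <= (1 + e) * B n.
Proof.
move=> e0; pose c := Num.min 2^-1 e.
have c0 : 0 < c by rewrite lt_min invr_gt0 e0 andbT.
have ce : c <= e by rewrite ge_min lexx orbT.
have c1 : c <= 2^-1 by rewrite ge_min lexx.
have : \forall n \near \oo, forall k, (1 <= k <= n.+1)%N -> v k <= c * B n.+1 ^+ 2.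
  have [N _ HN] := variance_negligible c0; exists N => // n /= Nn.
  exact: HN n.+1 (leqW Nn).
apply: filterS => n /(_ n.+1); rewrite leqnn => /(_ isT).
have := Bn_sqrS n; have := Bn_ge0 n; have := Bn_ge0 n.+1.
move=> h1 h0 E H.
rewrite -ler_sqr ?nnegrE// ?mulr_ge0//; last by lra.
rewrite exprMn.
have b2 := sqr_ge0 (B n); have b2' := sqr_ge0 (B n.+1).
apply: (@le_trans _ _ ((1 + c) ^+ 2 * ((1 - c) * B n.+1 ^+ 2))).
  rewrite mulrA ler_peMl//; nra.
apply: (@le_trans _ _ ((1 + c) ^+ 2 * B n ^+ 2)).
  by rewrite ler_wpM2l ?sqr_ge0//; lra.
rewrite ler_wpM2r// ler_sqr ?nnegrE; lra.
Unshelve. all: by end_near. Qed.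

Lemma g_near (e : R) : 0 < e ->
  \forall n \near \oo, forall j, (j <= n)%N -> `|g j| <= e * B n.
Proof.
move=> e0; have /eqoP/(_ e e0)[N _ HN] := g_small.
pose K := \sum_(0 <= j < N) `|g j|.
near=> n => j jn.
have [Nj|jN] := leqP N j.
  have := HN j Nj; rewrite /= (ger0_norm (Bn_ge0 j)) => /le_trans; apply.
  by rewrite ler_pM2l// Bn_le.
have : `|g j| <= K.
  rewrite /K (bigD1_seq j) ?iota_uniq//= ?mem_index_iota ?jN//.
  by rewrite lerDl sumr_ge0.
have : K / e <= B n by near: n; exact: Bn_near_ge.
rewrite ler_pdivrMr// mulrC => H1 H2; exact: le_trans H2 H1.
Unshelve. all: by end_near. Qed.

Definition lindeberg_error_sum n (t L : R) : R := \sum_(1 <= k < n.+1) lindeberg_error X k t L.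

Lemma lindeberg_error_ge0 k (t L : R) : (1 <= k)%N -> 0 < t -> 0 < L -> 0 <= lindeberg_error X k t L.
Proof.
move=> k1 t0 L0; have := ltW (variance_at_gt0 var_pos_fin k1) => v0.
rewrite /lindeberg_error addr_ge0// mulr_ge0 ?sqr_ge0// ?divr_ge0 ?(ltW t0)//.
by rewrite addr_ge0 ?large_variance_ge0// mulr_ge0// divr_ge0 ?sqrtr_ge0 ?ltW.
Qed.

Lemma lindeberg_error_mono k (t u L : R) : (1 <= k)%N -> 0 < t -> t <= u -> 0 < L ->
  lindeberg_error X k u L <= lindeberg_error X k t L.
Proof.
move=> k1 t0 tu L0; have := ltW (variance_at_gt0 var_pos_fin k1) => v0.
have u0 := lt_le_trans t0 tu.
have iu : u^-1 <= t^-1 by rewrite lef_pV2.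
have su : (Num.sqrt u)^-1 <= (Num.sqrt t)^-1 by rewrite lef_pV2 ?posrE ?sqrtr_gt0// ler_wsqrtr.
have l0 := large_variance_ge0 X k L.
have w0 : 0 <= L / Num.sqrt u * v k by rewrite mulr_ge0// divr_ge0 ?sqrtr_ge0 ?ltW.
rewrite /lindeberg_error; apply: lerD.
  apply: ler_pM.
  - by rewrite divr_ge0// ltW.
  - by rewrite addr_ge0.
  - by rewrite ler_pM2l.
  - by rewrite lerD2r ler_wpM2r// ler_pM2l.
rewrite ler_pM2l// ler_sqr ?nnegrE ?divr_ge0// ?(ltW t0) ?(ltW u0)//.
by rewrite ler_wpM2l.
Qed.

(** The cubic remainders sum to at most a multiple of e, the squares of the
variances to at most their maximum times B(n)^2; both are relative to the
variance eta B(n)^2 that is kept in reserve. *)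
Lemma lindeberg_error_near (eta tau e0 : R) : 0 < eta -> 0 < tau -> 0 < e0 ->
  exists e : R, [/\ 0 < e, e <= e0 & \forall n \near \oo,
    lindeberg_error_sum n (eta * B n ^+ 2) (e * B n) <= tau /\
    Lam n (e * B n) <= tau * (e * B n) ^+ 2].
Proof.
move=> eta0 tau0 e00; have se0 : 0 < Num.sqrt eta by rewrite sqrtr_gt0.
pose c := tau * eta * Num.sqrt eta / 12.
have c0 : 0 < c by rewrite divr_gt0// !mulr_gt0.
pose e := Num.min e0 c.
have ep : 0 < e by rewrite lt_min e00.
have ec : e <= c by rewrite ge_min lexx orbT.
exists e; split => //; first by rewrite ge_min lexx.
near=> n.
have n1 : (1 <= n)%N by near: n; exact: nbhs_infty_ge.
have B0 := Bn_gt0 n1; have b2 : 0 < B n ^+ 2 by rewrite exprn_gt0.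
split; last first.
  rewrite exprMn mulrA; near: n; apply: lindeberg_near => //.
  by rewrite mulr_gt0// exprn_gt0.
have HL : Lam n (e * B n) <= tau * eta / 12 * B n ^+ 2.
  by near: n; apply: lindeberg_near => //; rewrite divr_gt0// mulr_gt0.
have HV : forall k, (1 <= k <= n)%N -> v k <= tau * eta ^+ 2 / 9 * B n ^+ 2.
  by near: n; apply: variance_negligible; rewrite divr_gt0// mulr_gt0// exprn_gt0.
pose t := eta * B n ^+ 2.
have t0 : 0 < t by rewrite mulr_gt0.
rewrite -/t /lindeberg_error_sum.
have H1 k : (1 <= k <= n)%N -> lindeberg_error X k t (e * B n) <=
   4 / t * (e * B n / Num.sqrt t) * v k + 4 / t * large_variance X k (e * B n) +
   3 / t ^+ 2 * (tau * eta ^+ 2 / 9 * B n ^+ 2) * v k.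
  move=> kn; have vk := HV k kn; case/andP: kn => k1 kn.
  have v0 := ltW (variance_at_gt0 var_pos_fin k1).
  rewrite /lindeberg_error mulrDr [4 / t * (e * B n / Num.sqrt t * v k)]mulrA lerD2l.
  rewrite expr_div_n.
  have -> : 3 * (v k ^+ 2 / t ^+ 2) = 3 / t ^+ 2 * (v k * v k) by rewrite expr2; ring.
  rewrite -[leRHS]mulrA ler_pM2l ?divr_gt0 ?exprn_gt0//.
  by rewrite ler_wpM2r.
apply: (@le_trans _ _ (\sum_(1 <= k < n.+1) (4 / t * (e * B n / Num.sqrt t) * v k + 4 / t * large_variance X k (e * B n) +
   3 / t ^+ 2 * (tau * eta ^+ 2 / 9 * B n ^+ 2) * v k))).
  rewrite big_nat_cond [leRHS]big_nat_cond; apply: ler_sum => k; rewrite andbT ltnS.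
  exact: H1.
rewrite !big_split/= -!mulr_sumr -Bn_sqr_sum -/(Lam n (e * B n)).
have st : Num.sqrt t = Num.sqrt eta * B n.
  by rewrite sqrtrM ?(ltW eta0)// sqrtr_sqr ger0_norm// ltW.
have -> : 4 / t * (e * B n / Num.sqrt t) * B n ^+ 2 = 4 * e / (eta * Num.sqrt eta).
  by rewrite st /t; field; rewrite !gt_eqF.
have -> : 3 / t ^+ 2 * (tau * eta ^+ 2 / 9 * B n ^+ 2) * B n ^+ 2 = tau / 3.
  by rewrite /t; field; rewrite !gt_eqF.
have T1 : 4 * e / (eta * Num.sqrt eta) <= tau / 3.
  by rewrite ler_pdivrMr ?mulr_gt0//; move: ec; rewrite /c; lra.
have T2 : 4 / t * Lam n (e * B n) <= tau / 3.
  rewrite mulrAC ler_pdivrMr// /t; move: HL; lra.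
lra.
Unshelve. all: by end_near. Qed.

End lindeberg_consequences.

(** * The heat flow along the killed walk *)

Section telescoping.
Context {R : realType}.
Implicit Types (u e l : nat -> R) (c x y z : R).

Lemma telescope_lower u e c m n : (m <= n)%N ->
  (forall j, (m <= j < n)%N -> u j - e j * c <= u j.+1) ->
  u m - (\sum_(m <= j < n) e j) * c <= u n.
Proof.
move=> /subnK <-; rewrite addnC; elim: (n - m)%N => [|k IH] H.
  by rewrite addn0 big_geq// mul0r subr0.
rewrite addnS big_nat_recr ?leq_addr//=.
have := H (m + k)%N; rewrite leq_addr addnS leqnn => /(_ isT).
have : u m - (\sum_(m <= j < m + k) e j) * c <= u (m + k)%N.
  by apply: IH => j /andP[mj jk]; apply: H; rewrite mj addnS ltnW.
lra.
Qed.

Lemma killed_step_lower (x y z c1 e p q : R) :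
  `|x - y| <= e * p -> x = z + c1 -> c1 <= 0 -> e * p <= e * q -> y - e * q <= z.
Proof. by move=> H xE ? ?; move: H; rewrite xE ler_norml => /andP[H _]; lra. Qed.

Lemma killed_step_upper (x y z c1 e l p q : R) :
  `|x - y| <= e * p -> x = z + c1 -> - (l * p) <= c1 -> (e + l) * p <= (e + l) * q ->
  - y - (e + l) * q <= - z.
Proof. by move=> H xE ? ?; move: H; rewrite xE ler_norml => /andP[_ H]; lra. Qed.

Lemma overshoot_ge0 (s x G L : R) : - G <= s -> `|x| < L -> 0 <= s + x + (G + L).
Proof. by rewrite ltr_norml => ? /andP[? _]; lra. Qed.

End telescoping.

Section asymptotics.
Context {d : measure_display} {Omega : measurableType d} {R : realType}.
Context (P : probability Omega R) (X : nat -> {RV P >-> R}) (g : nat -> R).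
Hypothesis indep : mutually_independent [set k : nat | (1 <= k)%N] X.
Hypothesis mean0 : forall k : nat, (1 <= k)%N -> ('E_P[X k] = 0)%E.
Hypothesis var_pos_fin : forall k : nat, (1 <= k)%N ->
  (0 < second_moment X k < +oo)%E.
Hypothesis lind : lindeberg X.
Hypothesis g_small : g =o_\oo Bn X.
Hypothesis a_gt0 : forall n, (1 <= n)%N -> 0 < survival_prob X g n.

Local Notation S := (partial_sum X).
Local Notation D := (T_gt X g).
Local Notation integ f := (P.-integrable setT (EFin \o f)).
Local Notation Pr A := (fine (P A)).
Local Notation B := (Bn X).
Local Notation v := (variance_at X).
Local Notation Lam := (large_variance_sum X).
Local Notation a := (survival_prob X g).
Local Notation W := (killed_mean X g).
Local Notation V := (killed_height X g).
Local Notation M := (killed_square X g).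
Local Notation Err := (lindeberg_error_sum X).

Let mD n := @measurable_survival _ _ _ P X g n.
Let mS n := @measurable_partial_sum _ _ _ P X n.
Let pD n := @past_survival _ _ _ P X g n n (leqnn n).
Let BS := Bn_sqrS var_pos_fin.
Let Ble := Bn_le var_pos_fin.
Let B0 := Bn_ge0 X.

Lemma Bn_sqr_le m n : (m <= n)%N -> B m ^+ 2 <= B n ^+ 2.
Proof. by move=> mn; rewrite ler_sqr ?nnegrE ?B0// Ble. Qed.

(** The reserve t plus the variance of the steps from j to n. *)
Definition remaining_time (t : R) n j := t + (B n ^+ 2 - B j ^+ 2).
Local Notation clock := remaining_time.

Let clock_end t n : clock t n n = t.
Proof. by rewrite /clock subrr addr0. Qed.

Let clock_start t n : clock t n 0%N = t + B n ^+ 2.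
Proof. by rewrite /clock Bn0 expr0n subr0. Qed.

Let clock_gt0 t n j : (j <= n)%N -> 0 < t -> 0 < clock t n j.
Proof. by move=> jn t0; rewrite (lt_le_trans t0)// lerDl subr_ge0 Bn_sqr_le. Qed.

Let clock_ge t n j : (j <= n)%N -> t <= clock t n j.
Proof. by move=> jn; rewrite lerDl subr_ge0 Bn_sqr_le. Qed.

Let clockS t n j : clock t n j.+1 + v j.+1 = clock t n j.
Proof. by rewrite /clock BS; ring. Qed.

Opaque remaining_time.

Let step_error A j n (t L b : R) : past X j A -> (j.+1 <= n)%N -> 0 < t -> 0 < L ->
  `|\int[P]_(w in A) heat (clock t n j.+1) (S j.+1 w + b) -
    \int[P]_(w in A) heat (clock t n j) (S j w + b)| <=
  lindeberg_error X j.+1 t L * Pr A.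
Proof.
move=> pA jn t0 L0; have tc := clock_ge t jn.
rewrite -(clockS t n j).
apply: (le_trans (heat_survival_step indep mean0 var_pos_fin b pA (lt_le_trans t0 tc) L0)).
apply: ler_wpM2r; first exact: fine_ge0.
exact: lindeberg_error_mono.
Qed.

Let error_part m n (t L : R) : (m <= n)%N -> 0 < t -> 0 < L ->
  \sum_(m <= j < n) lindeberg_error X j.+1 t L <= Err n t L.
Proof.
move=> mn t0 L0; rewrite /lindeberg_error_sum big_add1/=.
rewrite [leRHS](@big_cat_nat _ _ _ m 0 n)//= lerDr.
by apply: sumr_ge0 => i _; exact: lindeberg_error_ge0.
Qed.

Lemma large_variance_part m n (L : R) : (m <= n)%N ->
  \sum_(m <= j < n) large_variance X j.+1 L <= Lam n L.
Proof.
move=> mn; rewrite /large_variance_sum big_add1/=.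
rewrite [leRHS](@big_cat_nat _ _ _ m 0 n)//= lerDr.
by apply: sumr_ge0 => i _; exact: large_variance_ge0.
Qed.

Lemma heat_unkilled n (t L b : R) : 0 < t -> 0 < L ->
  `|\int[P]_w heat t (S n w + b) - heat (t + B n ^+ 2) b| <= Err n t L.
Proof.
move=> t0 L0.
suff H k : (k <= n)%N -> `|\int[P]_w heat (clock t n k) (S k w + b) - heat (t + B n ^+ 2) b| <=
    \sum_(0 <= j < k) lindeberg_error X j.+1 t L.
  have := H n (leqnn n); rewrite clock_end => /le_trans; apply.
  exact: error_part.
elim: k => [_|k IH kn].
  rewrite big_geq// normr_le0 subr_eq0 clock_start.
  under eq_Rintegral do rewrite partial_sum0 add0r.
  by rewrite Rexpectation_cst.
rewrite big_nat_recr//=.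
have pT : past X k setT by exact: (@measurableT _ (past_type X k)).
have := step_error b pT kn t0 L0; rewrite -[X in fine X]/(P setT) probability_setT mulr1 => H.
apply: le_trans (ler_distD (\int[P]_w heat (clock t n k) (S k w + b)) _ _) _.
by rewrite addrC lerD// IH// ltnW.
Qed.

(** With the walk lowered by -b, every exit happens at a nonpositive position,
where the heat function is nonpositive: dropping the exits only increases the
right-hand side. *)
Lemma heat_killed_lower m n (t L b : R) : (m <= n)%N -> 0 < t -> 0 < L ->
  (forall j, (j <= n)%N -> g j + b <= 0) ->
  \int[P]_(w in D m) heat (clock t n m) (S m w + b) - Err n t L * a m <=
  \int[P]_(w in D n) heat t (S n w + b).
Proof.
move=> mn t0 L0 gb.
pose u j := \int[P]_(w in D j) heat (clock t n j) (S j w + b).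
have un : u n = \int[P]_(w in D n) heat t (S n w + b).
  by rewrite /u clock_end.
rewrite -un -/(u m).
apply: (@le_trans _ _ (u m - (\sum_(m <= j < n) lindeberg_error X j.+1 t L) * a m)).
  rewrite lerD2l lerN2; apply: ler_wpM2r; first exact: (survival_prob_ge0 X g m).
  exact: error_part.
apply: (@telescope_lower _ u (fun j => lindeberg_error X j.+1 t L) (a m) m n mn) => j /andP[mj jn].
have mE := @measurable_exit _ _ _ P X g j.
have iH := integ_heat P (clock t n j.+1) b (@mS j.+1).
apply: (killed_step_lower (step_error b (@pD j) jn t0 L0) (survival_split X g j iH)).
  apply: (@le_trans _ _ (\int[P]_(w in D j `\` D j.+1) (0 : R))); last first.
    by rewrite Rintegral_cst ?mul0r.
  apply: le_Rintegral; [exact: mE|exact: (integ_on mE iH)|exact: (integ_on mE (integ_cst P 0))|].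
  move=> w Dw; apply: erf_le0; rewrite pmulr_lle0; last first.
    rewrite invr_gt0 sqrtr_gt0; apply: mulr_gt0; [by []|exact: clock_gt0].
  by apply: le_trans (gb _ jn); rewrite lerD2r; exact: exit_le.
apply: ler_wpM2l; first exact: (lindeberg_error_ge0 var_pos_fin (ltn0Sn j) t0 L0).
exact: (survival_prob_decr X g mj).
Qed.

Lemma survival_ge j (G : R) w : 0 <= G -> (forall i, (i <= j)%N -> - G <= g i) ->
  D j w -> - G <= S j w.
Proof.
case: j => [|j] G0 gG Dw; first by rewrite partial_sum0 oppr_le0.
by apply: (le_trans (gG _ (leqnn j.+1))); apply/ltW/survival_gt.
Qed.

(** With the walk raised by G + H, an exit at a negative position requires a jump
larger than H, and the heat function is at least -1 there. *)
Lemma heat_killed_upper m n (t L H G : R) : (m <= n)%N -> 0 < t -> 0 < L -> 0 < H ->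
  0 <= G -> (forall j, (j <= n)%N -> - G <= g j) ->
  \int[P]_(w in D n) heat t (S n w + (G + H)) <=
  \int[P]_(w in D m) heat (clock t n m) (S m w + (G + H)) +
  (Err n t L + Lam n H / H ^+ 2) * a m.
Proof.
move=> mn t0 L0 H0 G0 gG.
have Sge j w (jn : (j <= n)%N) (Dw : D j w) : - G <= S j w :=
  survival_ge G0 (fun i ij => gG i (leq_trans ij jn)) Dw.
set b := G + H.
pose u j := \int[P]_(w in D j) heat (clock t n j) (S j w + b).
have un : u n = \int[P]_(w in D n) heat t (S n w + b).
  by rewrite /u clock_end.
rewrite -un -/(u m).
pose e j := lindeberg_error X j.+1 t L + large_variance X j.+1 H / H ^+ 2.
have e0 j : 0 <= e j.
  apply: addr_ge0; first exact: (lindeberg_error_ge0 var_pos_fin (ltn0Sn j) t0 L0).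
  by rewrite divr_ge0 ?sqr_ge0 ?large_variance_ge0.
have main : - u m - (\sum_(m <= j < n) e j) * a m <= - u n.
  apply: (@telescope_lower _ (fun j => - u j) e (a m) m n mn) => j /andP[mj jn].
  have mE := @measurable_exit _ _ _ P X g j.
  have iH := integ_heat P (clock t n j.+1) b (@mS j.+1).
  have iL := integ_large_prob X j.+1 H.
  apply: (killed_step_upper (step_error b (@pD j) jn t0 L0) (survival_split X g j iH)).
    apply: (@le_trans _ _ (- \int[P]_(w in D j) (H <= `|X j.+1 w|)%R%:R)).
      rewrite lerN2. exact: (next_large_prob indep var_pos_fin (@pD j) H0).
    apply: (@le_trans _ _ (\int[P]_(w in D j `\` D j.+1) (-1 * (H <= `|X j.+1 w|)%R%:R))).
      rewrite (RintegralZl _ mE (integ_on mE iL)).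
      rewrite mulN1r lerN2 (survival_split X g j iL) lerDr.
      by apply: Rintegral_ge0 => w _; exact: ler0n.
    apply: le_Rintegral; [exact: mE|exact: (integ_on mE (integZ (-1) iL))|exact: (integ_on mE iH)|].
    move=> w [Dw _]; case: (leP H `|X j.+1 w|) => [HX|XH].
      by rewrite mulr1 erf_geN1.
    rewrite mulr0; apply: erf_ge0; apply: divr_ge0; last exact: sqrtr_ge0.
    rewrite partial_sumS; exact: overshoot_ge0 (Sge j w (ltnW jn) Dw) XH.
  by apply: ler_wpM2l; [exact: e0|exact: (survival_prob_decr X g mj)].
have : (\sum_(m <= j < n) e j) * a m <= (Err n t L + Lam n H / H ^+ 2) * a m.
  apply: ler_wpM2r; first exact: (survival_prob_ge0 X g m).
  rewrite big_split/= -mulr_suml; apply: lerD.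
    exact: error_part.
  by apply: ler_wpM2r; [rewrite invr_ge0 sqr_ge0|exact: large_variance_part].
move: main; move: (u n) (u m) (_ * a m) (_ * a m) => u1 u2 x y; lra.
Qed.

End asymptotics.

(** * A priori estimates *)

Section a_priori.
Context {d : measure_display} {Omega : measurableType d} {R : realType}.
Context (P : probability Omega R) (X : nat -> {RV P >-> R}) (g : nat -> R).
Hypothesis indep : mutually_independent [set k : nat | (1 <= k)%N] X.
Hypothesis mean0 : forall k : nat, (1 <= k)%N -> ('E_P[X k] = 0)%E.
Hypothesis var_pos_fin : forall k : nat, (1 <= k)%N ->
  (0 < second_moment X k < +oo)%E.
Hypothesis lind : lindeberg X.
Hypothesis g_small : g =o_\oo Bn X.
Hypothesis a_gt0 : forall n, (1 <= n)%N -> 0 < survival_prob X g n.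

Local Notation S := (partial_sum X).
Local Notation D := (T_gt X g).
Local Notation integ f := (P.-integrable setT (EFin \o f)).
Local Notation Pr A := (fine (P A)).
Local Notation B := (Bn X).
Local Notation v := (variance_at X).
Local Notation Lam := (large_variance_sum X).
Local Notation a := (survival_prob X g).
Local Notation W := (killed_mean X g).
Local Notation V := (killed_height X g).
Local Notation M := (killed_square X g).
Local Notation Err := (lindeberg_error_sum X).

Let mD n := @measurable_survival _ _ _ P X g n.
Let mS n := @measurable_partial_sum _ _ _ P X n.
Let iS n := @integ_partial_sum _ _ _ P X var_pos_fin n.

Let above (c x : R) : R := (c <= x)%R%:R.

Let above01 c x : 0 <= above c x <= 1.
Proof. by rewrite /above ler0n lern1 leq_b1. Qed.

Let above_mono c x y : x <= y -> above c x <= above c y.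
Proof. by rewrite /above; case: (leP c x) => // cx xy; rewrite (le_trans cx xy). Qed.

Let measurable_above c : measurable_fun setT (above c).
Proof. by apply: nondecreasing_measurable => // x y; exact: above_mono. Qed.

Let integ_above c (Y : Omega -> R) : measurable_fun setT Y -> integ (fun w => above c (Y w)).
Proof.
move=> mY; apply: (@integ_bounded _ _ _ _ _ 1); first exact: measurableT_comp (measurable_above c) mY.
by move=> w; have /andP[? ?] := above01 c (Y w); rewrite ger0_norm.
Qed.

(** The free walk, run through the heat function with a small reserve and the
starting point lowered by B(n) / 4: the heat function is at most -3/4 at final
positions below B(n) / 8, while its initial value is at least -1/2. *)
Lemma partial_sum_spread : \forall n \near \oo,
  10^-1 <= \int[P]_w (B n / 8 <= S n w)%R%:R :> R.
Proof.
have [|y y0 yE] := @erf_near1 R (3 / 4); first by lra.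
(* With this reserve the argument of erf at the position -B(n) / 8 is exactly -y. *)
pose eta : R := (128 * y ^+ 2)^-1.
have eta0 : 0 < eta by rewrite invr_gt0 mulr_gt0// exprn_gt0.
have t16 : 0 < 16^-1 :> R by rewrite invr_gt0.
have [e [e0 _ He]] := lindeberg_error_near var_pos_fin lind eta0 t16 ltr01.
near=> n.
have n1 : (1 <= n)%N by near: n; exact: nbhs_infty_ge.
have B0 := Bn_gt0 var_pos_fin n1.
have [E1 _] : Err n (eta * B n ^+ 2) (e * B n) <= 16^-1 /\ Lam n (e * B n) <= 16^-1 * (e * B n) ^+ 2.
  by near: n; exact: He.
pose t := eta * B n ^+ 2.
have t0 : 0 < t by rewrite mulr_gt0// exprn_gt0.
have eB0 : 0 < e * B n by rewrite mulr_gt0.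
have /ler_normlP[H _] := heat_unkilled indep mean0 var_pos_fin n (- (B n / 4)) t0 eB0.
have H1 : - (1 / 2) <= heat (t + B n ^+ 2) (- (B n / 4)).
  rewrite /heat mulNr erf_odd lerN2.
  have s1 : B n <= Num.sqrt (2 * (t + B n ^+ 2)).
    rewrite -[leLHS](ger0_norm (ltW B0)) -sqrtr_sqr ler_wsqrtr//.
    by have := sqr_ge0 (B n); lra.
  have s0 := lt_le_trans B0 s1.
  apply: (le_trans (erf_le_tangent _)).
    by rewrite divr_ge0// ?divr_ge0// ltW.
  apply: (@le_trans _ _ (2 * 4^-1)); last by lra.
  apply: ler_pM; rewrite ?erf_slope_le2 ?(ltW (@erf_slope_gt0 R))//.
    by rewrite divr_ge0 ?divr_ge0// ltW.
  by rewrite ler_pdivrMr//; lra.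
have H2 : \int[P]_w heat t (S n w + - (B n / 4)) <= 7 / 4 * (\int[P]_w (B n / 8 <= S n w)%R%:R) - 3 / 4.
  have ia := integ_above (B n / 8) (@mS n).
  rewrite -(Rexpectation_cst P (3 / 4)) -(RintegralZl _ measurableT ia).
  rewrite -(RintegralB measurableT (integZ (7 / 4) ia) (integ_cst P (3 / 4))).
  apply: le_Rintegral => //.
  - exact: integ_heat.
  - apply: integB; [exact: (integZ (7 / 4) ia)|exact: integ_cst].
  move=> w _; have := heat_norm_le1 t (S n w + - (B n / 4)); rewrite ler_norml => /andP[_ h1].
  rewrite /above; case: (leP (B n / 8) (S n w)) => [_|Sn].
    apply: le_trans h1 _.
    by rewrite mulr1 (_ : 7 / 4 - 3 / 4 = 1)//; field.
  rewrite mulr0 sub0r /heat.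
  have st : Num.sqrt (2 * t) = B n / (8 * y).
    have -> : 2 * t = (B n / (8 * y)) ^+ 2 by rewrite /t /eta; field; rewrite gt_eqF.
    by rewrite sqrtr_sqr ger0_norm// divr_ge0 ?mulr_ge0// ltW.
  apply: (@le_trans _ _ (erf (- y))); last by rewrite erf_odd lerN2.
  apply: erf_nondecreasing; rewrite st ler_pdivrMr ?divr_gt0 ?mulr_gt0//.
  have -> : - y * (B n / (8 * y)) = - (B n / 8) by field; rewrite gt_eqF.
  lra.
move: H E1; rewrite -/t; lra.
Unshelve. all: by end_near. Qed.

(** By [association], given survival the walk is above B(n) / 8 with probability at
least 1/10, and there it exceeds the boundary by at least B(n) / 16. *)
Lemma survival_prob_le : exists C : R, 0 < C /\ \forall n \near \oo, B n * a n <= C * V n.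
Proof.
exists 160; split; first by rewrite ltr0n.
near=> n.
have n1 : (1 <= n)%N by near: n; exact: nbhs_infty_ge.
have B0 := Bn_gt0 var_pos_fin n1.
have p10 : 10^-1 <= \int[P]_w (B n / 8 <= S n w)%R%:R :> R.
  by near: n; exact: partial_sum_spread.
have gB : forall j, (j <= n)%N -> `|g j| <= 16^-1 * B n.
  by near: n; apply: g_near => //; rewrite invr_gt0.
have := association g indep n (@above_mono (B n / 8)) (above01 (B n / 8)).
have : B n / 16 * \int[P]_(w in D n) above (B n / 8) (S n w) <= V n.
  have ia := integ_above (B n / 8) (@mS n).
  rewrite -(RintegralZl _ (mD n) (integ_on (mD n) ia)) /killed_height.
  apply: le_Rintegral => //.
  - by apply: integ_on => //; exact: (integZ (B n / 16) ia).
  - by apply: integ_on => //; apply: integB => //; exact: integ_cst.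
  move=> w Dw; have := survival_gt n1 Dw; have := gB n (leqnn n).
  rewrite ler_norml /above => /andP[_ gn] Sg; case: (leP (B n / 8) (S n w)) => H.
    rewrite mulr1; apply: le_trans (lerB H gn).
    by rewrite (_ : B n / 8 - 16^-1 * B n = B n / 16)//; field.
  by rewrite mulr0 subr_ge0 ltW.
rewrite /above; set Q := \int[P]_(w in D n) _ => H1 H2.
have a0 := survival_prob_ge0 X g n.
have : 10^-1 * a n <= Q by apply: le_trans H2; rewrite ler_wpM2r.
move=> H3.
have : B n / 16 * (10^-1 * a n) <= B n / 16 * Q by rewrite ler_pM2l// divr_gt0.
lra.
Unshelve. all: by end_near. Qed.

Lemma killed_mean_lower_run (G : R) m n : (m <= n)%N ->
  (forall j, (j <= n)%N -> `|g j| <= G) ->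
  W m - G * a m <= W n.
Proof.
move=> mn gG; have G0 : 0 <= G by exact: le_trans (normr_ge0 _) (gG 0%N _).
suff H k : (m + k <= n)%N -> W m - G * (a m - a (m + k)%N) <= W (m + k)%N.
  have := H (n - m)%N; rewrite subnKC// => /(_ (leqnn n)); apply: le_trans.
  rewrite lerD2l lerN2 ler_wpM2l//; have := survival_prob_ge0 X g n; lra.
elim: k => [_|k IH]; first by rewrite addn0; lra.
rewrite addnS => kn; have := IH (ltnW kn).
have := killed_mean_lower g indep mean0 var_pos_fin (m + k).
have := gG _ kn; have := survival_prob_decrS X g (m + k).
set x := a (m + k)%N; set x' := a (m + k).+1 => xx gg.
have : `|g (m + k).+1| * (x - x') <= G * (x - x') by rewrite ler_wpM2r// subr_ge0.
lra.
Qed.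

Lemma killed_mean_upper_run (G L : R) m n : (m <= n)%N -> 0 < L ->
  (forall j, (j <= n)%N -> `|g j| <= G) ->
  W n <= W m + (G + L + Lam n L / L) * a m.
Proof.
move=> mn L0 gG; have G0 : 0 <= G by exact: le_trans (normr_ge0 _) (gG 0%N _).
suff H k : (m + k <= n)%N -> W (m + k)%N <= W m + (G + L) * (a m - a (m + k)%N) +
    (\sum_(m <= j < m + k) large_variance X j.+1 L) / L * a m.
  have := H (n - m)%N; rewrite subnKC// => /(_ (leqnn n)) /le_trans; apply.
  rewrite [leRHS](_ : _ = W m + (G + L) * a m + Lam n L / L * a m); last by ring.
  apply: lerD.
    rewrite lerD2l ler_wpM2l ?addr_ge0 ?(ltW L0)//.
    have := survival_prob_ge0 X g n; lra.
  apply: ler_wpM2r; first exact: survival_prob_ge0.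
  by rewrite ler_pM2r ?invr_gt0//; exact: large_variance_part.
elim: k => [_|k IH]; first by rewrite addn0 big_geq// mul0r; lra.
rewrite addnS => kn; have := IH (ltnW kn); rewrite big_nat_recr ?leq_addr//=.
have gG' j : (j <= (m + k))%N -> - G <= g j.
  by move=> jn; have := gG j (leq_trans jn (ltnW kn)); rewrite ler_norml => /andP[].
have := killed_mean_upper indep mean0 var_pos_fin L0 gG' G0.
set x := a (m + k)%N; set x' := a (m + k).+1.
have : large_variance X (m + k).+1 L / L * x <= large_variance X (m + k).+1 L / L * a m.
  by rewrite ler_wpM2l ?divr_ge0 ?large_variance_ge0 ?(ltW L0)// survival_prob_decr// leq_addr.
lra.
Qed.

(** Between times m and n the killed mean changes by at most o(B(n)) a(m), and
B(n) a(m) is at most a constant times V(m) when B(m) >= delta B(n). *)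
Lemma killed_height_slowly_varies (delta e : R) : 0 < delta -> 0 < e ->
  exists N, forall m n, (N <= m <= n)%N -> delta * B n <= B m -> `|V n - V m| <= e * V m.
Proof.
move=> d0 e0; have [C [C0 [N1 _ H1]]] := survival_prob_le.
pose c := e * delta / (6 * C).
have c0 : 0 < c by rewrite divr_gt0 ?mulr_gt0.
have [N2 _ H2] := g_near var_pos_fin lind g_small c0.
have c20 : 0 < c ^+ 2 by rewrite exprn_gt0.
have [N3 _ H3] := lindeberg_near var_pos_fin lind c0 c20.
exists (maxn 1 (maxn N1 (maxn N2 N3))) => m n /andP[]; rewrite !geq_max => /and4P[m1 N1m N2m N3m] mn dB.
have {H1}H1 := H1 m N1m.
have {H2}H2 := H2 n (leq_trans N2m mn).
have {H3}H3 := H3 n (leq_trans N3m mn).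
have n1 := leq_trans m1 mn.
have Bn0 := Bn_gt0 var_pos_fin n1; have Bm0 := Bn_gt0 var_pos_fin m1.
have L0 : 0 < c * B n by rewrite mulr_gt0.
have lo := killed_mean_lower_run mn H2.
have up := killed_mean_upper_run mn L0 H2.
have LL : Lam n (c * B n) / (c * B n) <= c * B n.
  rewrite ler_pdivrMr//; apply: le_trans H3 _; rewrite le_eqVlt; apply/orP; left; apply/eqP; ring.
have am0 := survival_prob_ge0 X g m; have an0 := survival_prob_ge0 X g n.
have anm : a n <= a m by exact: survival_prob_decr.
have x1 : Lam n (c * B n) / (c * B n) * a m <= c * B n * a m by rewrite ler_wpM2r.
have gm := H2 m mn; have gn := H2 n (leqnn n).
have y1 : `|g n * a n| <= c * B n * a m.
  by rewrite normrM (ger0_norm an0); apply: ler_pM.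
have y2 : `|g m * a m| <= c * B n * a m.
  by rewrite normrM (ger0_norm am0) ler_wpM2r.
have z : c * B n * a m <= e / 6 * V m.
  have -> : c * B n * a m = e / (6 * C) * (delta * B n * a m).
    by rewrite /c; field; rewrite gt_eqF.
  have k0 : 0 < e / (6 * C) by rewrite divr_gt0 ?mulr_gt0.
  apply: (@le_trans _ _ (e / (6 * C) * (B m * a m))).
    by rewrite (ler_pM2l k0) ler_wpM2r.
  apply: (@le_trans _ _ (e / (6 * C) * (C * V m))); first by rewrite (ler_pM2l k0).
  by rewrite le_eqVlt; apply/orP; left; apply/eqP; field; rewrite gt_eqF.
rewrite !killed_heightE// in z *.
move: y1 y2; rewrite !ler_norml => /andP[? ?] /andP[? ?].
apply/andP; split; lra.
Qed.

(** The killed second moment grows by at most the variance of a step times a(n),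
that is by a multiple of V(n) (B(n+1) - B(n)). Up to the small correction th B a,
which compensates the moving boundary, the quantity B(n) V(n) grows at least at the
same rate, so the two stay comparable along the induction. *)
Lemma killed_square_le : exists K : R, 0 < K /\ \forall n \near \oo, M n <= K * B n * V n.
Proof.
have [C [C0 [N1 _ H1]]] := survival_prob_le.
(* U below is V up to a factor 2; subtracting th * B * a makes its decrease
   due to the boundary proportional to B(n+1) - B(n). *)
pose th : R := (8 * C)^-1.
have th0 : 0 < th by rewrite invr_gt0 mulr_gt0.
have thC : th * C = 8^-1 by rewrite /th; field; rewrite gt_eqF.
have [N2 _ H2] := g_near var_pos_fin lind g_small th0.
have [N3 _ H3] := Bn_ratio var_pos_fin lind ltr01.
pose N := maxn 1 (maxn N1 (maxn N2 N3)).
pose U n := W n - th * B n * a n.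
have NP n : (N <= n)%N -> [/\ (1 <= n)%N, B n * a n <= C * V n, `|g n| <= th * B n,
    `|g n.+1| <= th * B n.+1 & B n.+1 <= 2 * B n].
  rewrite !geq_max => /and4P[n1 N1n N2n N3n]; split => //.
  - exact: H1.
  - exact: H2.
  - by apply: (H2 n.+1 (leqW N2n)).
  - exact: H3.
have UV n : (N <= n)%N -> [/\ V n <= 2 * U n, U n <= V n & 0 < U n].
  move=> /NP[n1 h1 h2 _ _].
  have V0 := killed_height_gt0 var_pos_fin n1 (a_gt0 n1).
  have a0 := survival_prob_ge0 X g n.
  have : `|g n * a n| <= th * B n * a n by rewrite normrM (ger0_norm a0) ler_wpM2r.
  rewrite ler_norml => /andP[? ?].
  have thE : th * B n * a n <= V n / 8.
    rewrite -mulrA (_ : V n / 8 = th * (C * V n)); last by rewrite mulrA thC mulrC.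
    by rewrite ler_pM2l.
  have E := killed_heightE g var_pos_fin n.
  rewrite /U; split; lra.
have Bst n : (N <= n)%N -> B n * U n + 2^-1 * U n * (B n.+1 - B n) <= B n.+1 * U n.+1.
  move=> Nn; have [n1 h1 h2 h3 h4] := NP n Nn; have [u1 u2 u0] := UV n Nn.
  have Bn0 := Bn_gt0 var_pos_fin n1; have dB := Bn_ltS var_pos_fin n.
  have a0 := survival_prob_ge0 X g n; have a1 := survival_prob_decrS X g n.
  have lo := killed_mean_lower g indep mean0 var_pos_fin n.
  have : `|g n.+1| * (a n - a n.+1) <= th * B n.+1 * (a n - a n.+1).
    by rewrite ler_wpM2r// subr_ge0.
  move=> lo2.
  have s1 : U n - th * (B n.+1 - B n) * a n <= U n.+1 by rewrite /U; lra.
  have Ba : B n * a n <= C * (2 * U n).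
    by apply: le_trans h1 _; rewrite ler_pM2l.
  have Ba' : B n.+1 * (th * a n) <= 2^-1 * U n.
    apply: (@le_trans _ _ (2 * B n * (th * a n))).
      by rewrite ler_wpM2r// mulr_ge0// ltW.
    have -> : 2 * B n * (th * a n) = 2 * th * (B n * a n) by ring.
    apply: (@le_trans _ _ (2 * th * (C * (2 * U n)))); first by rewrite ler_pM2l// mulr_gt0.
    have -> : 2 * th * (C * (2 * U n)) = 4 * (th * C) * U n by ring.
    by rewrite thC le_eqVlt; apply/orP; left; apply/eqP; field.
  have s2 : B n.+1 * (U n - th * (B n.+1 - B n) * a n) <= B n.+1 * U n.+1.
    by rewrite ler_pM2l// (lt_trans Bn0).
  have s3 : B n.+1 * (th * a n) * (B n.+1 - B n) <= 2^-1 * U n * (B n.+1 - B n).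
    by rewrite ler_wpM2r// subr_ge0 ltW.
  lra.
pose K := Num.max (12 * C) (M N / (B N * U N)).
have [N1' _ _ _ _] := NP N (leqnn N).
have KC : 12 * C <= K by rewrite le_max lexx.
have K0 : 0 < K by rewrite (lt_le_trans _ KC) ?mulr_gt0.
have main k : M (N + k)%N <= K * (B (N + k)%N * U (N + k)%N).
  elim: k => [|k IH].
    have [_ _ u0] := UV N (leqnn N).
    have bu : 0 < B N * U N by rewrite mulr_gt0// (Bn_gt0 var_pos_fin).
    by rewrite addn0 -ler_pdivrMr// /K le_max lexx orbT.
  rewrite addnS; set n := (N + k)%N in IH *.
  have Nn : (N <= n)%N by exact: leq_addr.
  have [n1 h1 h2 h3 h4] := NP n Nn; have [u1 u2 u0] := UV n Nn.
  have st := Bst n Nn.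
  have Bn0 := Bn_gt0 var_pos_fin n1; have dB := Bn_ltS var_pos_fin n.
  have a0 := survival_prob_ge0 X g n.
  have q := killed_squareS g indep mean0 var_pos_fin n.
  have vE := Bn_sqrS var_pos_fin n.
  have va : v n.+1 * a n <= 12 * C * (2^-1 * U n * (B n.+1 - B n)).
    have -> : v n.+1 = (B n.+1 - B n) * (B n.+1 + B n) by move: vE; rewrite !expr2; lra.
    have -> : 12 * C * (2^-1 * U n * (B n.+1 - B n)) = (B n.+1 - B n) * (3 * (C * (2 * U n))) by field.
    rewrite -mulrA ler_wpM2l ?subr_ge0 ?(ltW dB)//.
    apply: (@le_trans _ _ (3 * B n * a n)); first by rewrite ler_wpM2r//; lra.
    by rewrite -mulrA ler_pM2l//; apply: le_trans h1 _; rewrite ler_pM2l.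
  have := ler_wpM2l (ltW K0) st; rewrite mulrDr => st2.
  have : 12 * C * (2^-1 * U n * (B n.+1 - B n)) <= K * (2^-1 * U n * (B n.+1 - B n)).
    rewrite ler_wpM2r//; apply: mulr_ge0; last by rewrite subr_ge0 ltW.
    by apply: mulr_ge0; [rewrite invr_ge0|exact: ltW].
  lra.
exists K; split => //; exists N => // n /= Nn.
have := main (n - N)%N; rewrite subnKC// => /le_trans; apply.
have [_ uv _] := UV n Nn.
by rewrite -mulrA ler_pM2l// ler_wpM2l ?Bn_ge0.
Qed.

End a_priori.

(** * Comparison with an intermediate time *)

Section limit_algebra.
Context {R : realType}.

(** The bookkeeping of [survival_upper]. Here p and q stand for the survival
probabilities at times n and m, b for B(n), V and V' for the killed heights at m
and n, I and I' for the heat expectations at n and m, Y for the killed mean of the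
shifted walk at m, and root for the square root of the remaining time. *)
Lemma upper_algebra (delta s C b p q V V' I I' Y root : R) :
  0 < delta <= 2^-1 -> 0 < s -> 0 < C -> 0 < b -> 0 < root -> 0 <= V ->
  (1 - delta) * p <= I -> I <= I' + (delta ^+ 2 + delta ^+ 2) * q ->
  I' <= s * (Y / root) -> Y <= V + 3 * (delta ^+ 2 * b * q) ->
  delta * b * q <= 2 * C * V -> (1 - delta) * b <= root ->
  (1 - delta) * V <= V' ->
  (1 - delta) ^+ 3 * (p * b) <= (s * (1 + 6 * C * delta) + 4 * C * delta) * V'.
Proof.
move=> /andP[d0 d1] s0 C0 b0 r0 V0 H1 H2 H3 H4 H5 H6 H7.
have e0 : 0 < 1 - delta by lra.
have q1 : delta ^+ 2 * b * q <= delta * (2 * C * V).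
  by rewrite expr2 -!mulrA ler_pM2l// !mulrA.
have CV : 0 <= C * V by rewrite mulr_ge0// ltW.
have dCV : 0 <= delta * (C * V) by rewrite mulr_ge0// ltW.
have Y1 : Y <= (1 + 6 * C * delta) * V by lra.
have J : (1 - delta) * b * I' <= s * ((1 + 6 * C * delta) * V).
  have z : 0 <= s * ((1 + 6 * C * delta) * V).
    by rewrite mulr_ge0 ?(ltW s0)//; lra.
  have [I0|I0] := leP I' 0.
    by apply: le_trans z; rewrite mulr_ge0_le0// mulr_ge0// ltW.
  apply: (@le_trans _ _ (root * I')); first by rewrite ler_pM2r.
  apply: (@le_trans _ _ (s * Y)); last by rewrite ler_pM2l.
  by move: H3; rewrite mulrA ler_pdivlMr// mulrC.
have K1 : (1 - delta) * p * b <= I' * b + 2 * (delta ^+ 2 * b * q).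
  have : (1 - delta) * p * b <= (I' + (delta ^+ 2 + delta ^+ 2) * q) * b.
    by rewrite ler_pM2r// (le_trans H1).
  lra.
have K2 : (1 - delta) * ((1 - delta) * p * b) <=
    (s * (1 + 6 * C * delta) + 4 * C * delta) * V.
  apply: (@le_trans _ _ ((1 - delta) * (I' * b + 4 * C * delta * V))).
    by rewrite ler_pM2l//; lra.
  have : (1 - delta) * (4 * C * delta * V) <= 4 * C * delta * V.
    by rewrite ler_piMl//; lra.
  lra.
have E0 : 0 <= s * (1 + 6 * C * delta) + 4 * C * delta.
  have : 0 <= C * delta by rewrite mulr_ge0// ltW.
  by move=> h; rewrite addr_ge0 ?mulr_ge0 ?(ltW s0)//; lra.
apply: (@le_trans _ _ ((s * (1 + 6 * C * delta) + 4 * C * delta) * ((1 - delta) * V))); last first.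
  by rewrite ler_wpM2l.
have -> : (1 - delta) ^+ 3 * (p * b) = (1 - delta) * ((1 - delta) * ((1 - delta) * p * b)) by ring.
have -> : (s * (1 + 6 * C * delta) + 4 * C * delta) * ((1 - delta) * V) =
  (1 - delta) * ((s * (1 + 6 * C * delta) + 4 * C * delta) * V) by ring.
by rewrite ler_pM2l.
Qed.

(** The bookkeeping of [survival_lower], with the conventions of [upper_algebra]; M and Z are
the killed second moments at m of the walk and of the shifted walk, t is the
remaining time. *)
Lemma lower_algebra (delta s C K b p q V V' I I' Y Z M t root : R) :
  0 < delta <= 2^-1 -> 0 < s -> 0 < C -> 0 < K -> 0 < b -> 0 < root -> 0 <= V -> 0 <= p -> 0 <= q ->
  4 * C * delta <= 1 -> I <= p -> I' - delta ^+ 2 * q <= I ->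
  s * (Y / root) - Z / t <= I' -> V - 2 * (delta ^+ 2 * b * q) <= Y ->
  delta * b * q <= 2 * C * V -> root <= (1 + delta) * b -> b ^+ 2 / 2 <= t ->
  0 <= Z -> Z <= 2 * (M + (delta ^+ 2 * b) ^+ 2 * q) -> M <= K * (delta * b) * V ->
  0 <= V' -> V' <= (1 + delta) * V ->
  (s * (1 - delta - 4 * C * delta) - 4 * (K + 2 * C) * delta - 2 * C * delta) * V' <=
  (1 + delta) * (p * b).
Proof.
move=> /andP[d0 d1] s0 C0 K0 b0 r0 V0 p0 q0 Cd H1 H2 H3 H4 H5 H6 H7 Z0 H8 H9 V'0 H10.
set E := (X in X * V' <= _).
have q1 : delta ^+ 2 * b * q <= delta * (2 * C * V).
  by rewrite expr2 -!mulrA ler_pM2l// !mulrA.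
have q10 : 0 <= delta ^+ 2 * b * q by rewrite !mulr_ge0 ?sqr_ge0// ltW.
have dd : delta ^+ 2 <= 1 by nra.
have CV : 0 <= C * V by rewrite mulr_ge0// ltW.
have dV : 0 <= delta * V by rewrite mulr_ge0// ltW.
have Y1 : (1 - 4 * C * delta) * V <= Y by lra.
have Y0 : 0 <= Y by apply: le_trans Y1; rewrite mulr_ge0//; lra.
have t0 : 0 < t by apply: lt_le_trans H7; rewrite divr_gt0 ?exprn_gt0.
have A1 : (1 - delta - 4 * C * delta) * V <= Y / root * b.
  apply: (@le_trans _ _ ((1 - delta) * Y)).
    have : (1 - delta) * ((1 - 4 * C * delta) * V) <= (1 - delta) * Y.
      by rewrite ler_wpM2l//; lra.
    have : 0 <= delta * (4 * C * delta * V).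
      by rewrite !mulr_ge0// ltW.
    lra.
  rewrite mulrAC ler_pdivlMr//.
  apply: (@le_trans _ _ ((1 - delta) * Y * ((1 + delta) * b))).
    by rewrite ler_wpM2l// mulr_ge0//; lra.
  have -> : (1 - delta) * Y * ((1 + delta) * b) = Y * b - delta ^+ 2 * (Y * b) by ring.
  by rewrite lerBlDr lerDl mulr_ge0 ?sqr_ge0// mulr_ge0// ltW.
have A2 : Z / t * b <= 4 * (K + 2 * C) * delta * V.
  apply: (@le_trans _ _ (Z * (b ^+ 2 / 2)^-1 * b)).
    rewrite ler_pM2r// ler_wpM2l// lef_pV2 ?posrE//; by rewrite divr_gt0 ?exprn_gt0.
  have -> : Z * (b ^+ 2 / 2)^-1 * b = 2 * Z / b by field; rewrite gt_eqF.
  rewrite ler_pdivrMr//.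
  have : (delta ^+ 2 * b) ^+ 2 * q <= b * (delta * (2 * C * V)).
    have -> : (delta ^+ 2 * b) ^+ 2 * q = delta ^+ 2 * (b * (delta ^+ 2 * b * q)) by ring.
    apply: (@le_trans _ _ (b * (delta ^+ 2 * b * q))); last by rewrite ler_pM2l.
    by rewrite ler_piMl// mulr_ge0// ltW.
  lra.
have A3 : E * V <= p * b.
  have : (I' - delta ^+ 2 * q) * b <= p * b by rewrite ler_pM2r// (le_trans H2).
  have : (s * (Y / root) - Z / t) * b <= I' * b by rewrite ler_pM2r.
  have : s * ((1 - delta - 4 * C * delta) * V) <= s * (Y / root * b) by rewrite ler_pM2l.
  rewrite /E; lra.
have [E0|E0] := leP E 0.
  apply: (@le_trans _ _ 0); first by rewrite mulr_le0_ge0.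
  by rewrite !mulr_ge0 ?(ltW b0)//; lra.
apply: (@le_trans _ _ (E * ((1 + delta) * V))); first by rewrite ler_pM2l.
rewrite mulrCA ler_pM2l//; lra.
Qed.

End limit_algebra.

Section main_limit.
Context {d : measure_display} {Omega : measurableType d} {R : realType}.
Context (P : probability Omega R) (X : nat -> {RV P >-> R}) (g : nat -> R).
Hypothesis indep : mutually_independent [set k : nat | (1 <= k)%N] X.
Hypothesis mean0 : forall k : nat, (1 <= k)%N -> ('E_P[X k] = 0)%E.
Hypothesis var_pos_fin : forall k : nat, (1 <= k)%N ->
  (0 < second_moment X k < +oo)%E.
Hypothesis lind : lindeberg X.
Hypothesis g_small : g =o_\oo Bn X.
Hypothesis a_gt0 : forall n, (1 <= n)%N -> 0 < survival_prob X g n.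

Local Notation S := (partial_sum X).
Local Notation D := (T_gt X g).
Local Notation integ f := (P.-integrable setT (EFin \o f)).
Local Notation B := (Bn X).
Local Notation Lam := (large_variance_sum X).
Local Notation a := (survival_prob X g).
Local Notation W := (killed_mean X g).
Local Notation V := (killed_height X g).
Local Notation M := (killed_square X g).
Local Notation Err := (lindeberg_error_sum X).
Local Notation s := (Num.sqrt (2 / pi) : R).

Let mD n := @measurable_survival _ _ _ P X g n.
Let mS n := @measurable_partial_sum _ _ _ P X n.
Let iS n := @integ_partial_sum _ _ _ P X var_pos_fin n.
Let iS2 n := @integ_partial_sum2 _ _ _ P X var_pos_fin n.

Lemma sqrt2_slope (x t : R) : 0 < t ->
  2 / Num.sqrt pi * (x / Num.sqrt (2 * t)) = s * (x / Num.sqrt t).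
Proof.
move=> t0; have st0 : 0 < Num.sqrt t by rewrite sqrtr_gt0.
have p0 : 0 < Num.sqrt pi :> R by rewrite sqrtr_gt0 pi_gt0.
rewrite !sqrtrM// sqrtrV ?pi_ge0//.
have q0 : 0 < Num.sqrt 2 :> R by rewrite sqrtr_gt0.
have q2 : Num.sqrt 2 ^+ 2 = 2 :> R by rewrite sqr_sqrtr.
by rewrite -{1}q2; field; rewrite !gt_eqF.
Qed.

Lemma heat_le_linear (t x : R) : 0 < t -> 0 <= x -> heat t x <= s * (x / Num.sqrt t).
Proof.
move=> t0 x0; rewrite -sqrt2_slope//; apply: erf_le_tangent.
by rewrite divr_ge0// sqrtr_ge0.
Qed.

Lemma heat_ge_quadratic (t x : R) : 0 < t -> s * (x / Num.sqrt t) - x ^+ 2 / t <= heat t x.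
Proof.
move=> t0; apply: le_trans (erf_ge_quadratic _).
rewrite mulrBr sqrt2_slope// lerD2l lerN2 expr_div_n sqr_sqrtr ?mulr_ge0 ?(ltW t0)//.
rewrite (_ : x ^+ 2 / t = 2 * (x ^+ 2 / (2 * t))); last by field; rewrite gt_eqF.
apply: ler_wpM2r; last exact: erf_slope_le2.
by rewrite divr_ge0 ?sqr_ge0 ?mulr_ge0 ?(ltW t0).
Qed.

Lemma slope_le2 : s <= 2.
Proof.
have := sqrt2_slope 1 (@ltr01 R); rewrite mulr1 sqrtr1 divr1 mulr1 => <-.
rewrite -[leRHS]mulr1; apply: ler_pM; rewrite ?erf_slope_le2 ?(ltW erf_slope_gt0)//.
rewrite mul1r -[leRHS]invr1 lef_pV2 ?posrE ?sqrtr_gt0//.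
by rewrite -[leLHS]sqrtr1 ler_wsqrtr// ler1n.
Qed.

Lemma slope_gt0 : 0 < s.
Proof. by rewrite sqrtr_gt0 divr_gt0// pi_gt0. Qed.

(** The last time at which B is at most delta B(n) works, since consecutive values
of B have a ratio that tends to 1. *)
Lemma intermediate_time (delta : R) N0 : 0 < delta <= 1 ->
  exists N, forall n, (N <= n)%N -> exists m, [/\ (N0 <= m <= n)%N,
    delta / 2 * B n <= B m & B m <= delta * B n].
Proof.
move=> /andP[d0 d1].
have [N1 _ H1] := Bn_ratio var_pos_fin lind ltr01.
pose N2 := maxn N0 N1.
have [N3 _ H3] := Bn_near_ge var_pos_fin lind (B N2 / delta).
exists (maxn N2 N3) => n; rewrite geq_max => /andP[N2n N3n].
pose Q m := (m <= n)%N && (B m <= delta * B n).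
have QN : Q N2.
  by rewrite /Q N2n/= mulrC -ler_pdivrMr//; exact: H3.
have Qn m : Q m -> (m <= n)%N by case/andP.
have exQ : exists m, Q m by exists N2.
case: (ex_maxnP exQ Qn) => m /andP[mn Bm] mmax.
have N2m := mmax _ QN.
exists m; split => //; first by rewrite mn (leq_trans (leq_maxl _ _) N2m).
have Bn0 := Bn_ge0 X n.
have [mn'|] := ltnP m n; last first.
  move=> nm; have -> : m = n by apply/eqP; rewrite eqn_leq mn.
  rewrite ler_piMl//; lra.
have : ~~ Q m.+1 by apply/negP => /mmax; rewrite ltnn.
rewrite /Q mn'/= -ltNge => H.
have := H1 m (leq_trans (leq_maxr _ _) N2m); rewrite /= => H'.
lra.
Qed.

Lemma remaining_time_bounds (n m : nat) (eta delta : R) :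
  0 < delta <= 2^-1 -> 0 < eta <= delta -> 0 < B n -> B m <= delta * B n ->
  let t := remaining_time X (eta * B n ^+ 2) n m in
  [/\ 0 < t, B n ^+ 2 / 2 <= t, (1 - delta) * B n <= Num.sqrt t & Num.sqrt t <= (1 + delta) * B n].
Proof.
move=> /andP[d0 d1] /andP[e0 e1] B0 Bm t.
have Bm0 := Bn_ge0 X m.
have b2 : 0 < B n ^+ 2 by rewrite exprn_gt0.
have bm2 : B m ^+ 2 <= delta ^+ 2 * B n ^+ 2.
  by rewrite -exprMn ler_sqr ?nnegrE// mulr_ge0// ltW.
have bm20 := sqr_ge0 (B m).
have tE : t = eta * B n ^+ 2 + (B n ^+ 2 - B m ^+ 2) by [].
have dd : delta ^+ 2 * B n ^+ 2 <= delta / 2 * B n ^+ 2 by rewrite ler_pM2r//; nra.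
have db : delta * B n ^+ 2 <= 2^-1 * B n ^+ 2 by rewrite ler_pM2r.
have eb : eta * B n ^+ 2 <= delta * B n ^+ 2 by rewrite ler_pM2r.
have eb0 : 0 < eta * B n ^+ 2 by rewrite mulr_gt0.
have t2 : B n ^+ 2 / 2 <= t by rewrite tE; lra.
have t0 : 0 < t by rewrite (lt_le_trans _ t2)// divr_gt0.
split => //.
- have x0 : 0 <= (1 - delta) * B n by rewrite mulr_ge0 ?(ltW B0)//; lra.
  rewrite -[leLHS](ger0_norm x0) -sqrtr_sqr ler_wsqrtr// exprMn tE; nra.
- have x0 : 0 <= (1 + delta) * B n by rewrite mulr_ge0 ?(ltW B0)//; lra.
  rewrite -[leRHS](ger0_norm x0) -sqrtr_sqr ler_wsqrtr// exprMn tE; nra.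
Qed.

Lemma heat_mean_upper m (t b : R) : 0 < t -> (forall w, D m w -> 0 <= S m w + b) ->
  \int[P]_(w in D m) heat t (S m w + b) <= s * ((W m + b * a m) / Num.sqrt t).
Proof.
move=> t0 pos.
have iSb : integ (fun w => S m w + b) by apply: integD; [exact: iS|exact: integ_cst].
have iL := integZ (s / Num.sqrt t) iSb.
have E : \int[P]_(w in D m) (s / Num.sqrt t * (S m w + b)) = s * ((W m + b * a m) / Num.sqrt t).
  rewrite (RintegralZl _ (mD m) (integ_on (mD m) iSb)).
  rewrite (RintegralD (mD m) (integ_on (mD m) (iS m)) (integ_on (mD m) (integ_cst P b))).
  rewrite (Rintegral_cst P (mD m)) mulrAC -mulrA; congr (_ * _); exact: mulrC.
rewrite -E; apply: le_Rintegral; [exact: mD| |exact: (integ_on (mD m) iL)|].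
  exact: (integ_on (mD m) (integ_heat P t b (@mS m))).
move=> w Dw; apply: (le_trans (heat_le_linear t0 (pos w Dw))).
by rewrite mulrA (mulrAC s) .
Qed.

Lemma heat_mean_lower m (t b : R) : 0 < t ->
  s * ((W m + b * a m) / Num.sqrt t) - (\int[P]_(w in D m) (S m w + b) ^+ 2) / t <=
  \int[P]_(w in D m) heat t (S m w + b).
Proof.
move=> t0.
have iSb : integ (fun w => S m w + b) by apply: integD; [exact: iS|exact: integ_cst].
have iL := integZ (s / Num.sqrt t) iSb.
have iQ : integ (fun w => (S m w + b) ^+ 2).
  apply: (@integ_le _ _ _ _ _ (fun w => 2 * S m w ^+ 2 + 2 * b ^+ 2)).
  - by apply: measurable_funX; apply: measurable_funD => //; exact: mS.
  - move=> w; rewrite ger0_norm ?sqr_ge0//; have := sqr_ge0 (S m w - b); nra.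
  - by apply: integD; [exact: integZ|exact: integ_cst].
have iQt := integZ t^-1 iQ.
have E : \int[P]_(w in D m) (s / Num.sqrt t * (S m w + b)) = s * ((W m + b * a m) / Num.sqrt t).
  rewrite (RintegralZl _ (mD m) (integ_on (mD m) iSb)).
  rewrite (RintegralD (mD m) (integ_on (mD m) (iS m)) (integ_on (mD m) (integ_cst P b))).
  rewrite (Rintegral_cst P (mD m)) mulrAC -mulrA; congr (_ * _); exact: mulrC.
rewrite -E [X in _ - X]mulrC -(RintegralZl _ (mD m) (integ_on (mD m) iQ)).
rewrite -(RintegralB (mD m) (integ_on (mD m) iL) (integ_on (mD m) iQt)).
apply: le_Rintegral; [exact: mD| | |].
- exact: (integ_on (mD m) (integB iL iQt)).
- exact: (integ_on (mD m) (integ_heat P t b (@mS m))).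
move=> w Dw; apply: le_trans (heat_ge_quadratic _ t0).
by rewrite mulrA (mulrAC s) (mulrC t^-1).
Qed.

Lemma square_shift m (b : R) : \int[P]_(w in D m) (S m w + b) ^+ 2 <= 2 * (M m + b ^+ 2 * a m).
Proof.
have i2 : integ (fun w => 2 * S m w ^+ 2) by exact: integZ.
have ic := integ_cst P (2 * b ^+ 2).
have E : \int[P]_(w in D m) (2 * S m w ^+ 2 + 2 * b ^+ 2) = 2 * (M m + b ^+ 2 * a m).
  rewrite (RintegralD (mD m) (integ_on (mD m) i2) (integ_on (mD m) ic)).
  rewrite (RintegralZl _ (mD m) (integ_on (mD m) (@iS2 m))) (Rintegral_cst P (mD m)).
  by rewrite mulrDr mulrA.
rewrite -E; apply: le_Rintegral; [exact: mD| |exact: (integ_on (mD m) (integD i2 ic))|].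
  apply: (integ_on (mD m)); apply: (@integ_le _ _ _ _ _ (fun w => 2 * S m w ^+ 2 + 2 * b ^+ 2)).
  - by apply: measurable_funX; apply: measurable_funD => //; exact: mS.
  - move=> w; rewrite ger0_norm ?sqr_ge0//; have := sqr_ge0 (S m w - b); nra.
  - exact: integD.
move=> w _; have := sqr_ge0 (S m w - b); nra.
Qed.

End main_limit.

(** * Asymptotics of the survival probability *)

Section survival_asymptotics.
Context {d : measure_display} {Omega : measurableType d} {R : realType}.
Context (P : probability Omega R) (X : nat -> {RV P >-> R}) (g : nat -> R).
Hypothesis indep : mutually_independent [set k : nat | (1 <= k)%N] X.
Hypothesis mean0 : forall k : nat, (1 <= k)%N -> ('E_P[X k] = 0)%E.
Hypothesis var_pos_fin : forall k : nat, (1 <= k)%N ->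
  (0 < second_moment X k < +oo)%E.
Hypothesis lind : lindeberg X.
Hypothesis g_small : g =o_\oo Bn X.
Hypothesis a_gt0 : forall n, (1 <= n)%N -> 0 < survival_prob X g n.

Local Notation S := (partial_sum X).
Local Notation D := (T_gt X g).
Local Notation integ f := (P.-integrable setT (EFin \o f)).
Local Notation B := (Bn X).
Local Notation Lam := (large_variance_sum X).
Local Notation a := (survival_prob X g).
Local Notation W := (killed_mean X g).
Local Notation V := (killed_height X g).
Local Notation M := (killed_square X g).
Local Notation Err := (lindeberg_error_sum X).
Local Notation s := (Num.sqrt (2 / pi) : R).

Let mD n := @measurable_survival _ _ _ P X g n.
Let mS n := @measurable_partial_sum _ _ _ P X n.

Lemma comparison_times (delta C : R) : 0 < delta <= 2^-1 -> 0 < C ->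
  (\forall n \near \oo, B n * a n <= C * V n) ->
  forall N0, exists N, forall n, (N <= n)%N -> exists m,
  [/\ (1 <= m <= n)%N && (N0 <= m)%N, 0 < B n, B m <= delta * B n,
      delta * B n * a m <= 2 * C * V m & `|V n - V m| <= delta * V m].
Proof.
move=> dd C0 [N1 _ H1] N0; have /andP[d0 d1] := dd.
have d20 : 0 < delta / 2 by rewrite divr_gt0.
have [N2 H2] := killed_height_slowly_varies indep mean0 var_pos_fin lind g_small d20 d0.
have d1' : 0 < delta <= 1 by rewrite d0; lra.
have [N H] := intermediate_time var_pos_fin lind (maxn 1 (maxn N0 (maxn N1 N2))) d1'.
exists N => n /H[m [/andP[]]]; rewrite !geq_max => /and4P[m1 N0m N1m N2m] mn lo hi.
exists m; split => //.
- by rewrite m1 mn.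
- exact: (Bn_gt0 var_pos_fin (leq_trans m1 mn)).
- have := H1 m N1m; rewrite /= => H1m.
  have : delta / 2 * B n * a m <= B m * a m by rewrite ler_wpM2r// survival_prob_ge0.
  lra.
- by apply: H2 => //; rewrite N2m.
Qed.

Let shift_ge (x G : R) : - G <= x -> G <= x + (G + G).
Proof. by lra. Qed.

(** The reserve eta is chosen so small against the shift delta^2 B(n) that the heat
function is at least 1 - delta at every surviving position. *)
Lemma survival_upper (C : R) : 0 < C -> (\forall n \near \oo, B n * a n <= C * V n) ->
  forall delta : R, 0 < delta <= 2^-1 -> \forall n \near \oo,
  (1 - delta) ^+ 3 * (a n * B n) <= (s * (1 + 6 * C * delta) + 4 * C * delta) * V n.
Proof.
move=> C0 HC delta dd; have /andP[d0 d1] := dd.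
have [|y y0 yE] := @erf_near1 _ (1 - delta); first by lra.
have q0 : 0 < delta ^+ 2 by rewrite exprn_gt0.
(* The second bound makes G / sqrt (2 T) at least y. *)
pose eta := Num.min delta ((delta ^+ 2 / y) ^+ 2 / 2).
have eta0 : 0 < eta by rewrite lt_min d0 divr_gt0// exprn_gt0// divr_gt0.
have etad : eta <= delta by rewrite ge_min lexx.
have etay : eta <= (delta ^+ 2 / y) ^+ 2 / 2 by rewrite ge_min lexx orbT.
have [e [e0 _ [N1 _ H1]]] := lindeberg_error_near var_pos_fin lind eta0 q0 ltr01.
have q20 : 0 < delta ^+ 2 * (delta ^+ 2) ^+ 2 by rewrite mulr_gt0// exprn_gt0.
have [N2 _ H2] := lindeberg_near var_pos_fin lind q0 q20.
have [N3 _ H3] := g_near var_pos_fin lind g_small q0.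
have [N4 H4] := comparison_times dd C0 HC 0.
exists (maxn N4 (maxn N1 (maxn N2 N3))) => // n /=; rewrite !geq_max => /and4P[N4n N1n N2n N3n].
have [m [/andP[/andP[m1 mn] _] B0 Bm FB FV]] := H4 n N4n.
have [E1 _] := H1 n N1n; have E2 := H2 n N2n; have E3 := H3 n N3n.
move=> {H1 H2 H3 H4 HC}.
pose G := delta ^+ 2 * B n; have G0 : 0 < G by rewrite mulr_gt0.
pose T := eta * B n ^+ 2; have T0 : 0 < T by rewrite mulr_gt0// exprn_gt0.
have L0 : 0 < e * B n by rewrite mulr_gt0.
have ee : 0 < eta <= delta by rewrite eta0.
have [t0 _ st _] := remaining_time_bounds dd ee B0 Bm.
have gG j : (j <= n)%N -> - G <= g j by move=> /E3; rewrite ler_norml => /andP[].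
have up := heat_killed_upper indep mean0 var_pos_fin mn T0 L0 G0 (ltW G0) gG.
have V0 := ltW (killed_height_gt0 var_pos_fin m1 (a_gt0 m1)).
have posS k w : (k <= n)%N -> D k w -> - G <= S k w.
  by move=> kn; apply: (survival_ge (ltW G0)) => i ik; apply: gG; exact: leq_trans ik kn.
clear gG.
have F1 : (1 - delta) * a n <= \int[P]_(w in D n) heat T (S n w + (G + G)).
  rewrite -(Rintegral_cst P (mD n)); apply: le_Rintegral; [exact: mD| | |].
  - exact: (integ_on (mD n) (integ_cst P _)).
  - exact: (integ_on (mD n) (integ_heat P _ _ (@mS n))).
  move=> w Dw; apply: (le_trans yE); apply: erf_nondecreasing.
  have Sn := posS n w (leqnn n) Dw.
  have r0 : 0 < Num.sqrt (2 * T) by rewrite sqrtr_gt0 mulr_gt0.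
  rewrite ler_pdivlMr//.
  apply: (@le_trans _ _ G); last exact: shift_ge.
  rewrite -ler_pdivlMl// [leRHS]mulrC.
  have Gy0 : 0 <= G / y by rewrite divr_ge0// ltW.
  rewrite -[leRHS](ger0_norm Gy0) -sqrtr_sqr ler_wsqrtr//.
  have -> : (G / y) ^+ 2 = 2 * ((delta ^+ 2 / y) ^+ 2 / 2 * B n ^+ 2).
    by rewrite /G; field; rewrite gt_eqF.
  by rewrite ler_pM2l// ler_pM2r// exprn_gt0.
have pos w (Dw : D m w) : 0 <= S m w + (G + G).
  exact: le_trans (ltW G0) (shift_ge (posS m w mn Dw)).
have F3 := heat_mean_upper var_pos_fin t0 pos.
apply: (upper_algebra dd slope_gt0 C0 B0 _ V0 F1 _ F3 _ FB st).
- by rewrite sqrtr_gt0.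
- apply: (le_trans up); rewrite lerD2l; apply: ler_wpM2r; first exact: survival_prob_ge0.
  apply: lerD; first exact: E1.
  rewrite ler_pdivrMr ?exprn_gt0//; apply: (le_trans E2).
  by rewrite /G le_eqVlt; apply/orP; left; apply/eqP; ring.
- clear up F1 F3; rewrite killed_heightE//.
  have : `|g m * a m| <= G * a m.
    by rewrite normrM [X in _ * X]ger0_norm ?survival_prob_ge0// ler_wpM2r ?survival_prob_ge0// E3.
  rewrite ler_norml /G => /andP[_ ?]; lra.
- clear up F1 F3; by move: FV; rewrite ler_norml => /andP[? _]; lra.
Qed.

Lemma survival_lower (C K : R) : 0 < C -> (\forall n \near \oo, B n * a n <= C * V n) ->
  0 < K -> (\forall n \near \oo, M n <= K * B n * V n) ->
  forall delta : R, 0 < delta <= 2^-1 -> 4 * C * delta <= 1 -> \forall n \near \oo,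
  (s * (1 - delta - 4 * C * delta) - 4 * (K + 2 * C) * delta - 2 * C * delta) * V n <=
  (1 + delta) * (a n * B n).
Proof.
move=> C0 HC K0 [NK _ HK] delta dd Cd; have /andP[d0 d1] := dd.
have q0 : 0 < delta ^+ 2 by rewrite exprn_gt0.
have [e [e0 _ [N1 _ H1]]] := lindeberg_error_near var_pos_fin lind d0 q0 ltr01.
have [N3 _ H3] := g_near var_pos_fin lind g_small q0.
have [N4 H4] := comparison_times dd C0 HC NK.
exists (maxn N4 (maxn N1 N3)) => // n /=; rewrite !geq_max => /and3P[N4n N1n N3n].
have [m [/andP[/andP[m1 mn] NKm] B0 Bm FB FV]] := H4 n N4n.
have [E1 _] := H1 n N1n; have E3 := H3 n N3n; have MK := HK m NKm.
move=> {H1 H3 H4 HC HK}.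
pose G := delta ^+ 2 * B n; have G0 : 0 < G by rewrite mulr_gt0.
pose T := delta * B n ^+ 2; have T0 : 0 < T by rewrite mulr_gt0// exprn_gt0.
have L0 : 0 < e * B n by rewrite mulr_gt0.
have ee : 0 < delta <= delta by rewrite d0 lexx.
have [t0 t2 _ st] := remaining_time_bounds dd ee B0 Bm.
have gG j : (j <= n)%N -> g j + (- G) <= 0.
  by move=> /E3; rewrite ler_norml subr_le0 => /andP[].
have lo := heat_killed_lower indep mean0 var_pos_fin mn T0 L0 gG.
have V0 := ltW (killed_height_gt0 var_pos_fin m1 (a_gt0 m1)).
have V0' := ltW (killed_height_gt0 var_pos_fin (leq_trans m1 mn) (a_gt0 (leq_trans m1 mn))).
have F1 : \int[P]_(w in D n) heat T (S n w + (- G)) <= a n.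
  rewrite -[a n]mul1r -(Rintegral_cst P (mD n)); apply: le_Rintegral; [exact: mD| | |].
  - exact: (integ_on (mD n) (integ_heat P _ _ (@mS n))).
  - exact: (integ_on (mD n) (integ_cst P _)).
  by move=> w Dw; exact: erf_le1.
have F3 := heat_mean_lower g var_pos_fin m (- G) t0.
apply: (lower_algebra dd slope_gt0 C0 K0 B0 _ V0 (survival_prob_ge0 X g n) (survival_prob_ge0 X g m) Cd F1 _ F3 _ FB st t2 _ _ _ V0').
- by rewrite sqrtr_gt0.
- apply: le_trans lo; rewrite lerD2l lerN2; apply: ler_wpM2r => //; exact: survival_prob_ge0.
- clear lo F1 F3; rewrite killed_heightE//.
  have : `|g m * a m| <= G * a m.
    by rewrite normrM [X in _ * X]ger0_norm ?survival_prob_ge0// ler_wpM2r ?survival_prob_ge0// E3.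
  rewrite ler_norml /G => /andP[? ?]; lra.
- by apply: Rintegral_ge0 => w _; exact: sqr_ge0.
- by have H := square_shift g var_pos_fin m (- G); rewrite sqrrN in H; exact: H.
- by apply: (le_trans MK); rewrite ler_wpM2r// ler_pM2l.
- clear lo F1 F3; by move: FV; rewrite ler_norml => /andP[_ ?]; lra.
Qed.

Lemma survival_limit : (a n * B n / V n) @[n --> \oo] --> s.
Proof.
have [C [C0 HC]] := survival_prob_le indep mean0 var_pos_fin lind g_small.
have [K [K0 HK]] := killed_square_le indep mean0 var_pos_fin lind g_small a_gt0.
have s0 := @slope_gt0 R; have s2 := @slope_le2 R.
apply/cvgrPdist_le => eps eps0.
pose K1 : R := 6 * C * s + 4 * C + 3 * C.
pose K2 : R := s * (1 + 4 * C) + 4 * (K + 2 * C) + 2 * C + C.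
have sC : 0 < s * C by rewrite mulr_gt0.
have K10 : 0 < K1 by rewrite /K1; lra.
have K20 : 0 < K2 by rewrite /K2; lra.
pose delta := Num.min 2^-1 (Num.min (4 * C)^-1 (Num.min (eps / K1) (eps / K2))).
have d0 : 0 < delta.
  rewrite !lt_min; apply/and4P; split;
    [by rewrite invr_gt0|by rewrite invr_gt0 mulr_gt0|exact: divr_gt0|exact: divr_gt0].
have d1 : delta <= 2^-1 by rewrite ge_min lexx.
have d2 : delta <= (4 * C)^-1 by rewrite !ge_min lexx orbT.
have d3 : delta <= eps / K1 by rewrite !ge_min lexx !orbT.
have d4 : delta <= eps / K2 by rewrite !ge_min lexx !orbT.
have dd : 0 < delta <= 2^-1 by rewrite d0.
have dC : 4 * C * delta <= 1 by rewrite mulrC -ler_pdivlMr ?mulr_gt0// div1r.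
near=> n.
have n1 : (1 <= n)%N by near: n; exact: nbhs_infty_ge.
have V0 := killed_height_gt0 var_pos_fin n1 (a_gt0 n1).
have B0 := Bn_gt0 var_pos_fin n1.
have U : (1 - delta) ^+ 3 * (a n * B n) <= (s * (1 + 6 * C * delta) + 4 * C * delta) * V n.
  by near: n; exact: survival_upper.
have L : (s * (1 - delta - 4 * C * delta) - 4 * (K + 2 * C) * delta - 2 * C * delta) * V n <=
  (1 + delta) * (a n * B n) by near: n; exact: survival_lower.
have A : B n * a n <= C * V n by near: n.
pose r := a n * B n / V n.
have rE : a n * B n = r * V n by rewrite /r divfK// gt_eqF.
rewrite -/r.
have r0 : 0 <= r by rewrite divr_ge0 ?mulr_ge0 ?survival_prob_ge0 ?(ltW B0) ?(ltW V0).
clearbody r.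
move: U L A; rewrite (mulrC (B n)) rE !mulrA !ler_pM2r// => U L A.
have dC3 : delta * r <= delta * C by rewrite ler_pM2l.
have q : (1 - 3 * delta) * r <= (1 - delta) ^+ 3 * r.
  apply: ler_wpM2r => //.
  have : 0 <= delta ^+ 2 * (3 - delta) by rewrite mulr_ge0 ?sqr_ge0//; lra.
  lra.
move: d3 d4; rewrite !ler_pdivlMr// /K1 /K2 => d3 d4.
rewrite ler_norml; apply/andP; split; lra.
Unshelve. all: by end_near. Qed.

End survival_asymptotics.

(** * The slowly varying function *)

Section regular_function.
Context {d : measure_display} {Omega : measurableType d} {R : realType}.
Context (P : probability Omega R) (X : nat -> {RV P >-> R}) (g : nat -> R).
Hypothesis indep : mutually_independent [set k : nat | (1 <= k)%N] X.
Hypothesis mean0 : forall k : nat, (1 <= k)%N -> ('E_P[X k] = 0)%E.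
Hypothesis var_pos_fin : forall k : nat, (1 <= k)%N ->
  (0 < second_moment X k < +oo)%E.
Hypothesis lind : lindeberg X.
Hypothesis g_small : g =o_\oo Bn X.
Hypothesis a_gt0 : forall n, (1 <= n)%N -> 0 < survival_prob X g n.

Local Notation S := (partial_sum X).
Local Notation D := (T_gt X g).
Local Notation integ f := (P.-integrable setT (EFin \o f)).
Local Notation B := (Bn X).
Local Notation a := (survival_prob X g).
Local Notation W := (killed_mean X g).
Local Notation V := (killed_height X g).

Let mD n := @measurable_survival _ _ _ P X g n.
Let iS n := @integ_partial_sum _ _ _ P X var_pos_fin n.

Lemma expectation_onE (f : Omega -> R) A : measurable A -> integ f ->
  expectation_on P f A = (\int[P]_(w in A) f w)%:E.
Proof.
move=> mA fi; rewrite /Rintegral fineK; last by apply: integrable_fin_num => //; exact: integ_on.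
rewrite /expectation_on unlock integral_mkcond; apply: eq_integral => w _.
by rewrite restrict_EFin/= patch_indic.
Qed.

Lemma killed_height_expectation n :
  expectation_on P (fun w => S n w - g n) (D n) = (V n)%:E.
Proof.
by rewrite expectation_onE//; apply: integB => //; exact: integ_cst.
Qed.

Lemma T_leE n : T_le X g n = ~` D n.
Proof.
apply/seteqP; split => w /=; rewrite /T_le /T_gt /=.
  by rewrite leNgt => /negP.
by move=> /negP; rewrite -leNgt.
Qed.

Lemma exit_time n w : (D n `\` D n.+1) w -> first_passage_time X g w = n.+1%:R%:E.
Proof.
move=> Dw; have Sg := exit_le Dw; case: Dw => Dn _.
apply/eqP; rewrite eq_le; apply/andP; split.
  by apply: ereal_inf_lbound; exists n.+1.
apply: le_ereal_inf_tmp => _ [j [j1 Sj] <-]; rewrite lee_fin ler_nat ltnNge.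
apply/negP => jn; move: Dn; rewrite survivalE => /(_ j).
by rewrite j1 jn => /(_ isT); rewrite ltNge Sj.
Qed.

Lemma exit_stopped_sum n w : (D n `\` D n.+1) w -> stopped_sum X g w = S n.+1 w.
Proof. by move=> /exit_time; rewrite /stopped_sum => ->; rewrite /= natrK. Qed.

(** The event T_g <= n is the disjoint union of the exits at times 1, ..., n, and
[killed_meanS] telescopes over them. *)
Lemma stopped_sum_killed n :
  integ (fun w => - stopped_sum X g w * \1_(T_le X g n) w) /\
  \int[P]_w (- stopped_sum X g w * \1_(T_le X g n) w) = W n.
Proof.
elim: n => [|n [IHi IH]].
  have E w : - stopped_sum X g w * \1_(T_le X g 0) w = 0.
    by rewrite T_leE survival0 setCT indic0 mulr0.
  split; first by apply: eq_integrable (integ_cst P 0) => // w _ /=; rewrite E.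
  rewrite killed_mean0; under eq_Rintegral do rewrite E.
  exact: Rexpectation_cst.
have mE := @measurable_exit _ _ _ P X g n.
have E w : - stopped_sum X g w * \1_(T_le X g n.+1) w =
   - stopped_sum X g w * \1_(T_le X g n) w - S n.+1 w * \1_(D n `\` D n.+1) w.
  rewrite !T_leE !indicE !in_setC in_setD.
  have sub : w \in D n.+1 -> w \in D n by rewrite !inE survivalS => -[].
  have [w1|w1] := boolP (w \in D n.+1); first by rewrite (sub w1)/= !mulr0 subr0.
  have [w0|w0] := boolP (w \in D n) => /=; last by rewrite mulr0 subr0.
  rewrite mulr0 sub0r !mulr1 (@exit_stopped_sum n)//; split; first exact: set_mem.
  by move=> /mem_set; exact/negP.
have iE : integ (fun w => S n.+1 w * \1_(D n `\` D n.+1) w).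
  apply: (@integ_le _ _ _ _ _ (fun w => `|S n.+1 w|)); last exact: integrable_norm.
    apply: measurable_funM; [exact: measurable_partial_sum|exact: measurable_indic].
  by move=> w; rewrite normrM ler_piMr// indicE normr_nat lern1 leq_b1.
split; first by apply: eq_integrable (integB IHi iE) => // w _ /=; rewrite E.
under eq_Rintegral do rewrite E.
by rewrite (RintegralB measurableT IHi iE) IH (killed_meanS g indep mean0 var_pos_fin) -Rintegral_indic.
Qed.

Lemma killed_mean_expectation n :
  fine (expectation_on P (fun w => - stopped_sum X g w) (T_le X g n)) = W n.
Proof. by rewrite -(stopped_sum_killed n).2 Rexpectation. Qed.

(** The two-sided form of [killed_height_slowly_varies], for two indices in either
order. *)
Lemma killed_height_ratio (delta e : R) : 0 < delta -> 0 < e -> exists N, forall n k,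
  (N <= n)%N -> (N <= k)%N -> delta * B n <= B k -> delta * B k <= B n ->
  `|1 - V k / V n| <= e.
Proof.
move=> d0 e0; pose c := Num.min 2^-1 (e / 2).
have c0 : 0 < c by rewrite lt_min invr_gt0 divr_gt0// andbT.
have c1 : c <= 2^-1 by rewrite ge_min lexx.
have c2 : c <= e / 2 by rewrite ge_min lexx orbT.
have [N H] := killed_height_slowly_varies indep mean0 var_pos_fin lind g_small d0 c0.
exists (maxn 1 N) => n k; rewrite !geq_max => /andP[n1 Nn] /andP[k1 Nk] nk kn.
have Vn := killed_height_gt0 var_pos_fin n1 (a_gt0 n1).
have Vk := killed_height_gt0 var_pos_fin k1 (a_gt0 k1).
have -> : 1 - V k / V n = (V n - V k) / V n by field; rewrite gt_eqF.
rewrite normrM normfV (gtr0_norm Vn) ler_pdivrMr//.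
have [le_nk|lt_kn] := leqP n k.
  have := H n k; rewrite Nn le_nk => /(_ isT kn); rewrite distrC => /le_trans; apply.
  by rewrite ler_pM2r//; lra.
have := H k n; rewrite Nk (ltnW lt_kn) => /(_ isT nk).
move=> h; apply: (le_trans h).
have h2 : V k <= 2 * V n.
  move: h; rewrite ler_norml => /andP[h _].
  have : c * V k <= 2^-1 * V k by rewrite ler_pM2r.
  lra.
apply: (@le_trans _ _ (c * (2 * V n))); first by rewrite ler_pM2l.
have : c * V n <= e / 2 * V n by rewrite ler_pM2r.
lra.
Qed.

(** Outside the positive axis the level is set to 0 so that the chosen function is
monotone on the whole line, hence measurable. *)
Lemma level_exists (x : R) : exists n : nat,
  if 0 < x then B n ^+ 2 <= x < B n.+1 ^+ 2 else n == 0%N.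
Proof.
case: (boolP (0 < x)) => [x0|_]; last by exists 0%N.
have [N _ HN] := Bn_near_ge var_pos_fin lind (x + 1).
pose Q n := B n ^+ 2 <= x.
have exQ : exists n, Q n by exists 0%N; rewrite /Q Bn0 expr0n ltW.
have Qb n : Q n -> (n <= N)%N.
  move=> Qn; rewrite leqNgt; apply/negP => Nn; move: Qn; rewrite /Q leNgt => /negP; apply.
  have := HN n (ltnW Nn); rewrite /= => h; have : (x + 1) ^+ 2 <= B n ^+ 2.
    by rewrite ler_sqr ?nnegrE ?Bn_ge0// addr_ge0 ?(ltW x0).
  nra.
case: (ex_maxnP exQ Qb) => n Qn nmax; exists n.
apply/andP; split; first exact: Qn.
by rewrite ltNge; apply/negP => h; have := nmax n.+1 h; rewrite ltnn.
Qed.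

Lemma Bn_sqr_lt m n : (B m ^+ 2 < B n ^+ 2) = (m < n)%N.
Proof.
rewrite ltr_sqr ?nnegrE ?Bn_ge0//; apply/idP/idP => [h|mn].
  by rewrite ltnNge; apply/negP => /(Bn_le var_pos_fin); rewrite leNgt h.
exact: lt_le_trans (Bn_ltS var_pos_fin m) (Bn_le var_pos_fin mn).
Qed.

(** The level n = N(x) with B(n)^2 <= x < B(n+1)^2 is comparable in the B-scale
to the level of c x, and both tend to infinity. *)
Lemma regular_extension : exists U : R -> R,
  [/\ forall x : R, 0 < x -> 0 < U x, slowly_varying U &
      forall n : nat, (1 <= n)%N -> U (B n ^+ 2) = V n].
Proof.
have [N NP] := choice level_exists.
have NP0 x : 0 < x -> B (N x) ^+ 2 <= x < B (N x).+1 ^+ 2.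
  by move=> x0; have := NP x; rewrite x0.
have N_lt x n : 0 < x -> x < B n ^+ 2 -> (N x < n)%N.
  by move=> x0 xn; have /andP[h _] := NP0 x x0; rewrite -Bn_sqr_lt; exact: le_lt_trans xn.
have N_ge x n : 0 < x -> B n ^+ 2 <= x -> (n <= N x)%N.
  by move=> x0 xn; have /andP[_ h] := NP0 x x0; rewrite -ltnS -Bn_sqr_lt; exact: le_lt_trans h.
have NB n : (1 <= n)%N -> N (B n ^+ 2) = n.
  move=> n1; have b0 : 0 < B n ^+ 2 by rewrite exprn_gt0// (Bn_gt0 var_pos_fin).
  apply/eqP; rewrite eqn_leq N_ge// andbT -ltnS; apply: N_lt => //.
  by rewrite Bn_sqr_lt.
(* Below B(1)^2 the function is continued by its value at B(1)^2, which keeps it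
   positive. *)
pose vis n := V (maxn 1 n).
have vis0 n : 0 < vis n.
  by apply: (killed_height_gt0 var_pos_fin); [|apply: a_gt0]; rewrite leq_maxl.
exists (vis \o N); split.
- by move=> x _; exact: vis0.
- split.
    have N_mono : {homo (fun x => (N x)%:R : R) : x y / x <= y}.
      move=> x y xy; rewrite ler_nat; have := NP x; have := NP y.
      have [x0|x0] := ltP 0 x; last by move=> _ /eqP ->.
      rewrite (lt_le_trans x0 xy) => _ _; apply: N_ge; first exact: lt_le_trans xy.
      by have /andP[h _] := NP0 x x0; exact: le_trans xy.
    have mN : measurable_fun setT (fun x => (N x)%:R : R) by exact: nondecreasing_measurable.
    move=> mpos Y mY; apply: measurableI => //.
    rewrite (_ : _ @^-1` _ = \bigcup_(n in [set n | Y (vis n)]) (fun x => (N x)%:R : R) @^-1` [set n%:R]).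
      apply: bigcup_measurable => n _; have := mN measurableT _ (measurable_set1 (n%:R : R)).
      by rewrite setTI.
    apply/seteqP; split => x /=; first by move=> Yx; exists (N x).
    by move=> [n /= Yn /eqP]; rewrite eqr_nat => /eqP ->.
  move=> c c0; apply/cvgrPdist_le => e e0.
  pose delta : R := Num.min 1 (Num.min (4 * c)^-1 (c / 4)).
  have d0 : 0 < delta.
    by rewrite !lt_min ltr01 invr_gt0 mulr_gt0//= divr_gt0.
  have d1 : delta <= 1 by rewrite ge_min lexx.
  have d2 : delta * (4 * c) <= 1 by rewrite -ler_pdivlMr ?mulr_gt0// div1r !ge_min lexx orbT.
  have d3 : delta * 4 <= c by rewrite -ler_pdivlMr// !ge_min lexx !orbT.
  have dd : delta ^+ 2 <= delta by rewrite expr2 ler_piMr// ltW.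
  have [N1 H1] := killed_height_ratio d0 e0.
  have [N2 _ H2] := Bn_ratio var_pos_fin lind ltr01.
  pose N0 := maxn 1 (maxn N1 N2).
  near=> x.
  have x0 : 0 < x by near: x; apply: nbhs_pinfty_gt; exact: num_real.
  have cx0 : 0 < c * x by rewrite mulr_gt0.
  have xN : B N0 ^+ 2 <= x by near: x; apply: nbhs_pinfty_ge; exact: num_real.
  have cxN : B N0 ^+ 2 <= c * x.
    by rewrite mulrC -ler_pdivrMr//; near: x; apply: nbhs_pinfty_ge; exact: num_real.
  have := N_ge _ _ x0 xN; have := N_ge _ _ cx0 cxN.
  rewrite /vis/=; set k := N (c * x); set n := N x.
  rewrite !geq_max => /and3P[k1 N1k N2k] /and3P[n1 N1n N2n].
  rewrite (maxn_idPr k1) (maxn_idPr n1).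
  have /andP[n_lo n_hi] := NP0 _ x0; have /andP[k_lo k_hi] := NP0 _ cx0.
  rewrite -/n -/k in n_lo n_hi k_lo k_hi.
  have sq j : (N2 <= j)%N -> B j.+1 ^+ 2 <= 4 * B j ^+ 2.
    move=> /H2 /= h; rewrite [leRHS](_ : _ = ((1 + 1) * B j) ^+ 2); last by ring.
    by rewrite ler_sqr ?nnegrE ?mulr_ge0 ?Bn_ge0//; lra.
  have sn := sq n N2n; have sk := sq k N2k.
  have bn0 := sqr_ge0 (B n); have bk0 := sqr_ge0 (B k).
  have cmp (u v : nat) : delta * B u ^+ 2 <= B v ^+ 2 -> delta * B u <= B v.
    move=> h; rewrite -ler_sqr ?nnegrE ?mulr_ge0 ?Bn_ge0 ?(ltW d0)// exprMn.
    by apply: le_trans h; rewrite ler_wpM2r// sqr_ge0.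
  apply: H1 => //; apply: cmp.
    have : delta * 4 * B n ^+ 2 <= c * B n ^+ 2 by rewrite ler_wpM2r.
    have : c * B n ^+ 2 <= c * x by rewrite ler_pM2l.
    lra.
  have : delta * B k ^+ 2 <= delta * (c * (4 * B n ^+ 2)).
    rewrite ler_pM2l//; apply: (le_trans k_lo); rewrite ler_pM2l//.
    exact: le_trans (ltW n_hi) sn.
  have : delta * (4 * c) * B n ^+ 2 <= 1 * B n ^+ 2 by rewrite ler_wpM2r.
  lra.
- by move=> n n1; rewrite /= NB// /vis (maxn_idPr n1).
Unshelve. all: by end_near. Qed.

End regular_function.

Theorem theorem5p1 (d : measure_display) (Omega : measurableType d)
    (R : realType) (P : probability Omega R)
    (X : nat -> {RV P >-> R}) (g : nat -> R)
    (indep : mutually_independent [set k : nat | (1 <= k)%N] X)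
    (mean0 : forall k : nat, (1 <= k)%N -> ('E_P[X k] = 0)%E)
    (var_pos_fin : forall k : nat, (1 <= k)%N ->
       (0 < second_moment X k < +oo)%E)
    (lind : lindeberg X)
    (g_small : g =o_\oo Bn X)
    (T_pos : forall n : nat, (1 <= n)%N -> (0 < P (T_gt X g n))%E) :
  exists U : R -> R,
    [/\ forall x : R, 0 < x -> 0 < U x,
        slowly_varying U,
        forall n : nat, (1 <= n)%N ->
          (U (Bn X n ^+ 2))%:E =
          expectation_on P (fun w => partial_sum X n w - g n) (T_gt X g n),
        asymp_equiv
          (fun n => U (Bn X n ^+ 2))
          (fun n => fine (expectation_on P (fun w => - stopped_sum X g w)
                                         (T_le X g n)))
      & asymp_equiv
          (fun n => fine (P (T_gt X g n)))
          (fun n => Num.sqrt (2 / pi) * (U (Bn X n ^+ 2) / Bn X n))].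
Proof.
have a_gt0 n : (1 <= n)%N -> 0 < survival_prob X g n.
  move=> n1; apply: fine_gt0; rewrite T_pos//=.
  by rewrite (le_lt_trans (probability_le1 _ _)) ?ltry//; exact: measurable_survival.
have [U [U0 Usv UB]] := regular_extension indep mean0 var_pos_fin lind g_small a_gt0.
have [C [C0 HC]] := survival_prob_le indep mean0 var_pos_fin lind g_small.
exists U; split => //.
- by move=> n n1; rewrite UB// (killed_height_expectation g var_pos_fin).
- apply/cvgrPdist_le => e e0.
  pose c := Num.min (2 * C)^-1 (e / (2 * C)).
  have C2 : 0 < 2 * C by rewrite mulr_gt0.
  have c0 : 0 < c by rewrite lt_min invr_gt0 C2 divr_gt0.
  have c1 : c * (2 * C) <= 1 by rewrite -ler_pdivlMr// div1r ge_min lexx.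
  have c2 : c * (2 * C) <= e by rewrite -ler_pdivlMr// ge_min lexx orbT.
  near=> n.
  have n1 : (1 <= n)%N by near: n; exact: nbhs_infty_ge.
  have gn : forall j, (j <= n)%N -> `|g j| <= c * Bn X n by near: n; exact: g_near.
  have aC : Bn X n * survival_prob X g n <= C * killed_height X g n by near: n.
  rewrite UB// (killed_mean_expectation g indep mean0 var_pos_fin).
  have V0 := killed_height_gt0 var_pos_fin n1 (a_gt0 n n1).
  have E := killed_heightE g var_pos_fin n.
  have ga : `|g n * survival_prob X g n| <= c * (C * killed_height X g n).
    rewrite normrM [X in _ * X]ger0_norm ?survival_prob_ge0//.
    apply: (@le_trans _ _ (c * Bn X n * survival_prob X g n)).
      by rewrite ler_wpM2r ?survival_prob_ge0// gn.
    by rewrite -mulrA ler_pM2l.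
  have cV : c * (2 * C) * killed_height X g n <= 1 * killed_height X g n by rewrite ler_pM2r.
  have cVe : c * (2 * C) * killed_height X g n <= e * killed_height X g n by rewrite ler_pM2r.
  have W0 : killed_height X g n <= 2 * killed_mean X g n.
    by move: ga; rewrite ler_norml => /andP[? ?]; lra.
  have Wp : 0 < killed_mean X g n by lra.
  have -> : 1 - killed_height X g n / killed_mean X g n =
    g n * survival_prob X g n / killed_mean X g n.
    by rewrite E; field; rewrite gt_eqF.
  rewrite normrM normfV (gtr0_norm Wp) ler_pdivrMr//; apply: (le_trans ga).
  have : e * killed_height X g n <= e * (2 * killed_mean X g n) by rewrite ler_pM2l.
  lra.
- have s0 := @slope_gt0 R.
  have L := survival_limit indep mean0 var_pos_fin lind g_small a_gt0.
  have : survival_prob X g n * Bn X n / killed_height X g n / Num.sqrt (2 / pi)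
      @[n --> \oo] --> (Num.sqrt (2 / pi) / Num.sqrt (2 / pi) : R).
    by apply: cvgM; [exact: L|exact: cvg_cst].
  rewrite divff ?gt_eqF// => H; apply: cvg_trans H.
  apply: near_eq_cvg; near=> n.
  have n1 : (1 <= n)%N by near: n; exact: nbhs_infty_ge.
  have V0 := killed_height_gt0 var_pos_fin n1 (a_gt0 n n1).
  have B0 := Bn_gt0 var_pos_fin n1.
  rewrite UB// -/(survival_prob X g n); field.
  by rewrite !gt_eqF.
Unshelve. all: by end_near. Qed.
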